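(* Let $M$ be a simplicial complex which is tight with respect to some field. Let $C$ be an induced cycle in the link of a vertex $x$ in $M$. Then the induced subcomplex of $M$ on the vertex set of the cone $x\ast C$ (that is, on $V(C)\cup\{x\}$) is a closed, triangulated $2$-manifold.
   Context: All simplicial complexes are finite and abstract. For a simplicial complex $X$ with vertex set $V(X)$ and $A\subseteq V(X)$, the induced subcomplex is $X[A]=\{\alpha\in X:\alpha\subseteq A\}$. The link of a vertex $x$ in $X$ is $X_x=\{\alpha\in X: x\notin\alpha,\ \alpha\cup\{x\}\in X\}$. A closed, triangulated $2$-manifold is a simplicial complex whose geometric carrier is a closed topological $2$-manifold. Tight: for a field $\mathbb{F}$, $X$ is tight with respect to $\mathbb{F}$ if $X$ is connected and, for every induced subcomplex $Y$ of $X$, the linear map $H_*(Y;\mathbb{F})\to H_*(X;\mathbb{F})$ on simplicial homology induced by inclusion is injective. For $n\geq 3$, the $n$-cycle is the connected $1$-dimensional simplicial complex on $n$ vertices in which every vertex has degree two. An induced cycle in a simplicial complex $X$ is an induced subcomplex of $X$ which is a cycle (so a $3$-cycle is induced only if its three vertices do not span a $2$-face of $X$). $x\ast C=C\cup\{\alpha\cup\{x\}:\alpha\in C\}$ is the cone with apex $x$ and base $C$. *)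

(* Defs.v *)
From HB Require Import structures.
From mathcomp Require Import all_boot all_order all_algebra.
From mathcomp Require Import generic_quotient ring_quotient.
From mathcomp Require Import all_classical all_reals all_analysis.
(* Imported again so that [set0], [setT], ... denote finite sets. *)
From mathcomp Require Import finset.

Set Implicit Arguments.
Unset Strict Implicit.
Unset Printing Implicit Defensive.

Import Order.TTheory GRing.Theory Num.Theory.
Import numFieldNormedType.Exports.
Local Open Scope ring_scope.
Local Open Scope quotient_scope.

Section Complexes.
Context {T : finType}.
Implicit Types (X C : {set {set T}}) (A : {set T}) (x : T).

(* The empty set is a face of every complex; elements of [T] need not be
   vertices. *)
Definition simplicial_complex X :=
  finset.set0 \in X /\
  forall a b : {set T}, a \in X -> b \subset a -> b \in X.

Definition vertices X : {set T} := [set v | [set v]%SET \in X]%SET.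

Definition induced_subcomplex X A : {set {set T}} := [set a in X | a \subset A]%SET.

Definition link X x : {set {set T}} :=
  [set a in X | (x \notin a) && ((x |: a)%SET \in X)]%SET.

Definition cone x C : {set {set T}} :=
  (C :|: [set (x |: a)%SET | a in C])%SET.

Definition edge_rel X : rel T := fun u v => [set u; v]%SET \in X.

Definition connected_complex X :=
  {in vertices X &, forall u v, connect (edge_rel X) u v}.

Definition degree X (v : T) : nat := #|[set e in X | (#|e| == 2%N) && (v \in e)]%SET|.

(* An [i]-dimensional face has [i.+1] vertices. *)
Definition one_dimensional X := \max_(a in X) #|a| = 2%N.

Definition is_cycle C :=
  [/\ simplicial_complex C, (3 <= #|vertices C|)%N, connected_complex C,
      one_dimensional C & {in vertices C, forall v, degree C v = 2%N}].

Definition induced_cycle X C :=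
  is_cycle C /\ exists2 A : {set T}, A \subset vertices X & C = induced_subcomplex X A.

End Complexes.

Section VectorQuotient.
Context {F : fieldType} {V : vectType F}.

Definition vquot (U : {vspace V}) := Quotient.quot (pred_of_vspace U).

Variable U : {vspace V}.

HB.instance Definition _ := GRing.Zmodule.on (vquot U).
HB.instance Definition _ := EqQuotient.on (vquot U).

Definition vquot_pi (v : V) : vquot U := \pi_(vquot U) v.

Lemma vquot_piE v w : (vquot_pi v == vquot_pi w) = (v - w \in U).
Proof. by rewrite /vquot_pi Quotient.idealrBE. Qed.

Lemma vquot_reprK (q : vquot U) : vquot_pi (repr q) = q.
Proof. by rewrite /vquot_pi reprK. Qed.

Lemma vquot_pi_repr v : repr (vquot_pi v) - v \in U.
Proof. by rewrite -vquot_piE vquot_reprK. Qed.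

Lemma vquot_piD v w : vquot_pi (v + w) = vquot_pi v + vquot_pi w.
Proof. by rewrite /vquot_pi piE. Qed.

Definition vquot_scale (a : F) (q : vquot U) := vquot_pi (a *: repr q).

Lemma vquot_piZ a v : vquot_pi (a *: v) = vquot_scale a (vquot_pi v).
Proof.
apply/eqP; rewrite vquot_piE -scalerBr memvZ //.
by rewrite -opprB memvN vquot_pi_repr.
Qed.

Let scaleA a b q : vquot_scale a (vquot_scale b q) = vquot_scale (a * b) q.
Proof. by rewrite -[q]vquot_reprK -!vquot_piZ scalerA. Qed.
Let scale1 : left_id 1 vquot_scale.
Proof. by move=> q; rewrite -[q]vquot_reprK -!vquot_piZ scale1r. Qed.
Let scaleDr : right_distributive vquot_scale +%R.
Proof.
move=> a q r; rewrite -[q]vquot_reprK -[r]vquot_reprK.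
by rewrite -vquot_piD -!vquot_piZ scalerDr vquot_piD.
Qed.
Let scaleDl q : {morph vquot_scale^~ q : a b / a + b}.
Proof.
move=> a b /=; rewrite -[q]vquot_reprK.
by rewrite -!vquot_piZ scalerDl vquot_piD.
Qed.

HB.instance Definition _ := GRing.Zmodule_isLmodule.Build F (vquot U)
  scaleA scale1 scaleDr scaleDl.

Lemma vquot_pi_is_linear : linear vquot_pi.
Proof. by move=> a v w; rewrite vquot_piD vquot_piZ. Qed.
HB.instance Definition _ :=
  GRing.isLinear.Build F V (vquot U) _ vquot_pi vquot_pi_is_linear.

End VectorQuotient.

Section Homology.
Context {T : finType} (F : fieldType).
Implicit Types (X Y : {set {set T}}) (i : nat).

Definition chain := {ffun {set T} -> F^o}.
HB.instance Definition _ := Vector.on chain.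

Definition simplex_chain (s : {set T}) : chain := [ffun t => (t == s)%:R].

(* Simplices are oriented by the enumeration order of [T]. *)
Definition position (v : T) (s : {set T}) : nat :=
  #|[set u in s | (enum_rank u < enum_rank v)%N]%SET|.

(* Homology is not augmented: the boundary of a vertex is [0]. *)
Definition simplex_boundary (s : {set T}) : chain :=
  if (1 < #|s|)%N
  then \sum_(v in s) (-1) ^+ position v s *: simplex_chain (s :\ v)%SET
  else 0.

Definition boundary_fun (c : chain) : chain :=
  \sum_(s : {set T}) c s *: simplex_boundary s.

Lemma boundary_fun_is_linear : linear boundary_fun.
Proof.
move=> a c d; rewrite /boundary_fun scaler_sumr -big_split /=.
by apply: eq_bigr => s _; rewrite !ffunE scalerDl scalerA.
Qed.
HB.instance Definition _ :=
  GRing.isLinear.Build F chain chain _ boundary_fun boundary_fun_is_linear.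

Definition boundary : 'End(chain) := linfun boundary_fun.

Lemma boundaryE c : boundary c = boundary_fun c.
Proof. by rewrite lfunE. Qed.

Definition chains X i : {vspace chain} :=
  <<[seq simplex_chain s | s <- enum [set s in X | #|s| == i.+1]%SET]>>%VS.

Definition cycles X i : {vspace chain} := (chains X i :&: lker boundary)%VS.

Definition boundaries X i : {vspace chain} :=
  (boundary @: chains X i.+1)%VS.

Definition cycle_space X i := subvs_of (cycles X i).

(* The boundaries, as a subspace of the space of cycles. *)
Definition boundary_space X i : {vspace cycle_space X i} :=
  (linfun (vsval : cycle_space X i -> chain) @^-1: boundaries X i)%VS.

Lemma boundary_spaceE X i (z : cycle_space X i) :
  (z \in boundary_space X i) = (vsval z \in boundaries X i).
Proof.
by rewrite -memv_preim lfunE.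
Qed.

Definition homology X i := vquot (boundary_space X i).

Definition homology_class X i (z : cycle_space X i) : homology X i :=
  vquot_pi (boundary_space X i) z.

(* When [Y] is a subset of [X], [vsproj] is the inclusion of cycles. *)
Definition cycle_incl Y X i (z : cycle_space Y i) : cycle_space X i :=
  vsproj (cycles X i) (vsval z).

Definition homology_incl Y X i (h : homology Y i) : homology X i :=
  homology_class (cycle_incl X (repr h)).

Lemma chainsS Y X i : Y \subset X -> (chains Y i <= chains X i)%VS.
Proof.
move=> /fintype.subsetP YX; apply: sub_span => _ /mapP[s sY ->].
apply: map_f; move: sY; rewrite !mem_enum !inE => /andP[/YX -> ->] //.
Qed.

Lemma cyclesS Y X i : Y \subset X -> (cycles Y i <= cycles X i)%VS.
Proof. by move=> YX; apply: capvS => //; apply: chainsS. Qed.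

Lemma boundariesS Y X i : Y \subset X -> (boundaries Y i <= boundaries X i)%VS.
Proof. by move=> YX; apply: limgS; apply: chainsS. Qed.

Lemma cycle_inclE Y X i (z : cycle_space Y i) :
  Y \subset X -> vsval (cycle_incl X z) = vsval z.
Proof.
move=> YX; rewrite vsprojK //.
by apply: (subvP (cyclesS i YX)); apply: subvsP.
Qed.

Lemma homology_inclE Y X i (z : cycle_space Y i) : Y \subset X ->
  homology_incl X (homology_class z) = homology_class (cycle_incl X z).
Proof.
move=> YX; apply/eqP; rewrite vquot_piE boundary_spaceE linearB /=.
rewrite !cycle_inclE //; apply: (subvP (boundariesS i YX)).
by have := vquot_pi_repr (boundary_space Y i) z; rewrite boundary_spaceE linearB.
Qed.

Lemma homology_incl_is_linear Y X i : Y \subset X ->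
  linear (@homology_incl Y X i).
Proof.
move=> YX a h k; rewrite -[h]vquot_reprK -[k]vquot_reprK.
rewrite -[a *: _ + _]vquot_pi_is_linear !homology_inclE //.
rewrite -[RHS]vquot_pi_is_linear; congr (vquot_pi _ _).
by apply: val_inj; rewrite /= !cycle_inclE.
Qed.

(* Injectivity on [H_*] is injectivity in every degree. *)
Definition tight_complex X :=
  connected_complex X /\
  forall A : {set T}, A \subset vertices X ->
  forall i, injective (@homology_incl (induced_subcomplex X A) X i).

End Homology.

Section Manifolds.
Variable R : realType.

Definition homeomorphic (S1 S2 : topologicalType) :=
  exists (f : S1 -> S2) (g : S2 -> S1),
    [/\ continuous f, continuous g, cancel f g & cancel g f].

(* Open subsets are regarded as spaces through the subtype topology. *)
Definition closed_2manifold (S : topologicalType) :=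
  [/\ compact [set: S]%classic, hausdorff_space S, second_countable (T := S) &
    forall p : S, exists (U : set S) (V : set (R * R)%type),
      [/\ open U, U p, open V & homeomorphic U V]].

(* Barycentric coordinates; the carrier gets its topology as a subtype of the
   product space [R ^ T]. *)
Definition carrier (T : finType) (X : {set {set T}}) : set {ptws T -> R} :=
  [set p : {ptws T -> R} | [/\ forall v, 0 <= p v, \sum_v p v = 1 &
    [set v | p v != 0]%SET \in X]]%classic.

Definition closed_triangulated_2manifold (T : finType) (X : {set {set T}}) :=
  simplicial_complex X /\ closed_2manifold (carrier X).

End Manifolds.

(* Main.v *)
From HB Require Import structures.
Require Import Defs.
From mathcomp Require Import all_boot all_order all_algebra ring lra zify.
From mathcomp Require Import all_classical all_reals all_analysis.
From mathcomp Require Import fintype finset.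

Set Implicit Arguments.
Unset Strict Implicit.
Unset Printing Implicit Defensive.

Import Order.TTheory GRing.Theory Num.Theory.
Import numFieldNormedType.Exports.

(** Let [A] be the vertex set of the cycle [C] and [Y] the subcomplex induced on
    [x |: A].  The proof shows that the link in [Y] of every vertex is a cycle,
    and then that a finite complex with this property carries a closed surface.

    The link of [x] in [Y] is [C].  For a vertex [y] of [C] with neighbours [a]
    and [b] on [C], everything follows from one consequence of tightness,
    [tight_link_connected].  Suppose that [v, a, ..., b] is a cycle in the link of
    a vertex [u], all of whose vertices lie in a vertex set [B] without [u].  The
    cycle bounds the cone with apex [u], so by tightness it bounds a 2-chain [D] of
    the complex induced on [B].  The part of [D] at [v] is a 1-chain in the link of
    [v] whose boundary is [a - b] up to sign; hence [a] and [b] are joined by a path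
    in the link of [v] with all its vertices in [B].

    This is used twice, with the roles of [x] and [y] exchanged.
    - With [u = x], [v = y], [B = A] and the cycle [C], it gives a path from [a] to
      [b] in the link of [y] inside [A].
    - Such a path closes up through [x] to a cycle in the link of [y].  With
      [u = y], [v = x] and [B] the vertex set of this cycle, [a] and [b] are joined
      in the link of [x], that is along [C], through vertices of the path only.
      Since [C] minus [y] and one more vertex [w] separates [a] from [b], the path
      visits every vertex of [A] other than [y] ([path_covers]).
    A path from [a] to [b] no part of which can be bypassed has no chord.  So the
    edges of the link of [y] are those of this path and the two edges at [x]: the
    link is a cycle ([base_star]).  As no three vertices of a path are pairwise
    consecutive, no face through [y] has more than three vertices.

    For the topology, a point of the carrier has a positive coordinate at some
    vertex [v], so it lies in the open star of [v], which is an open cone over a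
    cycle.  Sending the [k]-th vertex of the cycle to a generator of the [k]-th
    ray of a complete fan of the plane, and extending linearly, identifies the open
    star with an open subset of the plane; the inverse is given by the piecewise
    linear coordinate functions of the fan ([open_star_homeomorphic]). *)

(** * Two-regular graphs as cyclic sequences *)

Section CyclicOrder.
Variables (T : finType) (e : rel T).
Hypotheses (e_sym : symmetric e) (e_irr : irreflexive e).

Lemma maximal_path q : exists p, [/\ path e q p, uniq (q :: p) &
  forall r, e (last q p) r -> r \in q :: p].
Proof.
suff grow n p : path e q p -> uniq (q :: p) -> (#|T| <= size p + n)%N ->
    exists p, [/\ path e q p, uniq (q :: p) & forall r, e (last q p) r -> r \in q :: p].
  exact: (grow #|T| [::]).
elim: n p => [|n IH] p ep up szp.
  have := card_uniqP up; have := max_card (mem (q :: p)); rewrite /= => h1 h2.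
  by move: h1; rewrite h2 ltnNge -[size p]addn0 szp.
have [/existsP[r /andP[er rp]]|] := boolP [exists r, e (last q p) r && (r \notin q :: p)].
  apply: (IH (rcons p r)); rewrite ?rcons_path ?ep //.
    by rewrite -rcons_cons rcons_uniq rp.
  by rewrite size_rcons addSnnS.
rewrite negb_exists => /forallP max_p; exists p; split=> // r er.
by have := max_p r; rewrite er negbK.
Qed.

Lemma next_neq_prev (c : seq T) q : uniq c -> (2 < size c)%N -> q \in c ->
  next c q != prev c q.
Proof.
move=> uc sc qc; apply/eqP => npE.
have : next c (next c q) = q by rewrite npE next_prev.
have [i c' cE] := rot_to qc; rewrite -!(next_rot i uc) cE.
have : uniq (rot i c) by rewrite rot_uniq.
have : (2 < size (rot i c))%N by rewrite size_rot.
rewrite cE; case: c' {cE} => [|r [|w c']] //= _.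
rewrite !inE !negb_or eqxx => /andP[/and3P[qr qw _] _].
by rewrite eq_sym (negPf qr) eqxx => wq; rewrite wq eqxx in qw.
Qed.

Hypothesis e_deg : forall q r, e q r -> #|[set w | e q w]| = 2.

Lemma two_neighbours q r1 r2 : e q r1 -> e q r2 -> r1 != r2 ->
  forall w, e q w = (w == r1) || (w == r2).
Proof.
move=> e1 e2 r12 w; have : [set r1; r2] == [set w | e q w].
  rewrite eqEcard (e_deg e1) cards2 r12 andbT.
  by apply/subsetP => z; rewrite !inE => /orP[] /eqP ->.
by move=> /eqP/setP/(_ w); rewrite !inE.
Qed.

(** A path from [q] that cannot be extended ends at a vertex [x] both of whose
    neighbours lie on the path.  The one that does not precede [x] is [q] itself,
    because an interior vertex would get a third neighbour.  So the path closes
    up, and its edges use up the degree of each of its vertices. *)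
Lemma two_regular_cycle q r : e q r -> exists c,
  [/\ uniq c, (2 < size c)%N, q \in c &
      {in c, forall u w, e u w = (w == next c u) || (w == prev c u)}].
Proof.
move=> eqr; have [p [ep up maxp]] := maximal_path q.
have [p' [x pE]] : exists p' x, p = rcons p' x.
  case: (lastP p) maxp {ep up} => [|p' x _]; last by exists p', x.
  by move=> /(_ r eqr); rewrite inE => /eqP rq; rewrite rq e_irr in eqr.
move: ep up maxp; rewrite {p}pE rcons_path last_rcons => /andP[ep ex] up maxp.
have [xq xp up'] : [/\ x != q, x \notin p' & uniq (q :: p')].
  move: up; rewrite -rcons_cons rcons_uniq inE negb_or => /andP[/andP[-> ->] ->].
  by [].
have exl : e x (last q p') by rewrite e_sym.
have [z ez zl] : exists2 z, e x z & z != last q p'.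
  have : [set w | e x w] :\ last q p' != set0.
    rewrite -card_gt0; have := cardsD1 (last q p') [set w | e x w].
    by rewrite (e_deg exl) inE exl; lia.
  by case/set0Pn => z; rewrite !inE => /andP[zl ez]; exists z.
have zx : z != x by apply: contraTneq ez => ->; rewrite e_irr.
have zqp : z \in q :: p'.
  by have := maxp z ez; rewrite -rcons_cons mem_rcons inE (negPf zx).
have zq : z = q.
  apply/eqP; apply: contraT => nzq.
  have zp : z \in p' by move: zqp; rewrite inE (negPf nzq).
  move: ep exl zl up' xp; case/splitPr: zp => p1 p2.
  rewrite cat_path last_cat /=; case: p2 => [|w p2] /=.
    by rewrite eqxx.
  move=> /and4P[_ ez1 ezw _] _ _ up' xp.
  have zex : e z x by rewrite e_sym.
  have zel : e z (last q p1) by rewrite e_sym.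
  have xw : x != w by apply: contraNneq xp => ->; rewrite mem_cat !inE eqxx !orbT.
  have := two_neighbours zex ezw xw (last q p1); rewrite zel => /esym/orP[] /eqP lE.
    have : x \in q :: p1 by rewrite -lE mem_last.
    by rewrite inE (negPf xq) /= => xp1; rewrite mem_cat xp1 in xp.
  have : w \in q :: p1 by rewrite -lE mem_last.
  have : uniq ((q :: p1) ++ [:: z, w & p2]) := up'.
  rewrite cat_uniq => /and3P[_ /hasPn/(_ w) + _].
  by rewrite !inE eqxx orbT => /(_ isT) /negP.
have p'0 : p' != [::] by apply: contraNneq zl => ->; rewrite zq.
pose c := q :: rcons p' x.
have sc : (2 < size c)%N by rewrite /= size_rcons; case: (p') p'0.
have cyc : cycle e c by rewrite /c /= !rcons_path last_rcons ep ex -zq.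
exists c; split=> //; first by rewrite inE eqxx.
move=> u uc w; apply: two_neighbours.
- exact: next_cycle.
- by rewrite e_sym; apply: prev_cycle.
- exact: next_neq_prev.
Qed.
End CyclicOrder.

(** Adjacency is expressed through [next], so the notion does not depend on
    where the cycle starts and any vertex can be rotated to the front. *)
Definition cyclic_order (T : finType) (e : rel T) (c : seq T) :=
  [/\ uniq c, (2 < size c)%N &
    forall q r, e q r = (q \in c) && ((r == next c q) || (q == next c r))].

(** The cycle through one edge is closed under adjacency, so connectedness makes
    it exhaust the complex. *)
Lemma cycle_cyclic_order (T : finType) (C : {set {set T}}) : is_cycle C ->
  exists c, cyclic_order (fun q r => (q != r) && ([set q; r] \in C)) c /\
    c =i vertices C.
Proof.
move=> [[_ Cdown] V3 Cconn _ Cdeg].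
pose e := fun q r => (q != r) && ([set q; r]%SET \in C).
have eV q r : e q r -> q \in vertices C.
  by move=> /andP[_ qrC]; rewrite inE; apply: Cdown qrC _; rewrite subsetUl.
have e_sym : symmetric e by move=> q r; rewrite /e eq_sym setUC.
have e_irr : irreflexive e by move=> q; rewrite /e eqxx.
have degE q : q \in vertices C -> #|[set w | e q w]| = 2%N.
  move=> qV; rewrite -(Cdeg q qV) /degree.
  rewrite -(@card_in_imset _ _ (fun w => [set q; w])); last first.
    move=> w1 w2; rewrite !inE => /andP[q1 _] _ wE.
    have : w1 \in [set q; w1] by rewrite !inE eqxx orbT.
    by rewrite wE !inE eq_sym (negPf q1) => /eqP.
  congr #|pred_of_set _|; apply/setP => s; rewrite !inE; apply/imsetP/idP.
    move=> [w]; rewrite inE => /andP[qw qwC] ->.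
    by rewrite qwC cards2 qw !inE eqxx.
  move=> /and3P[sC /cards2P[u [w [uw sE]]] qs].
  move: qs; rewrite sE !inE => /orP[] /eqP qE.
    by exists w; rewrite ?qE // inE /e uw -sE.
  by exists u; rewrite qE ?(setUC [set u]) // inE /e eq_sym uw setUC -sE.
have e_deg q r : e q r -> #|[set w | e q w]| = 2%N by move=> /eV /degE.
have [q qV] : exists q, q \in vertices C by apply/card_gt0P; lia.
have [r eqr] : exists r, e q r.
  have : (0 < #|[set w | e q w]|)%N by rewrite degE.
  by case/card_gt0P => r; rewrite inE; exists r.
have [c [uc sc qc cE]] := two_regular_cycle e_sym e_irr e_deg eqr.
have cV : c =i vertices C.
  move=> u; apply/idP/idP => [uc'|uV].
    by apply: (eV u (next c u)); rewrite cE // eqxx.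
  have := Cconn q u qV uV; case/connectP => p; elim: p (q) qc => [|w p IH] v vc /=.
    by move=> _ ->.
  move=> /andP[vw]; apply: IH; have [<- //|nvw] := eqVneq v w.
  have : e v w by rewrite /e nvw.
  by rewrite cE // => /orP[] /eqP ->; rewrite ?mem_next ?mem_prev.
exists c; split=> //; split=> // u w; rewrite -/(e u w).
have [uc'|uc'] := boolP (u \in c); last first.
  by apply: contraNF uc' => /eV; rewrite cV.
rewrite cE //=; congr (_ || _); apply/eqP/eqP => [->|->]; first by rewrite next_prev.
by rewrite prev_next.
Qed.

Section CyclicOrderTheory.
Variables (T : finType) (e : rel T).
Implicit Types (y q r w a : T) (p : seq T).

(** Once [y] is cut out, succession on the cycle is succession of indices in the
    remaining path; adjacency then becomes arithmetic. *)
Lemma next_cons_index y p q r : uniq (y :: p) -> q \in p -> r \in p ->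
  (r == next (y :: p) q) = (index r p == (index q p).+1).
Proof.
move=> /andP[yp up] qp rp; rewrite next_nth inE qp orbT /=.
have yq : y != q by apply: contraNneq yp => ->.
rewrite (negPf yq); apply/eqP/eqP => [rE|<-]; last by rewrite nth_index.
rewrite {1}rE index_uniq // ltnNge; apply/negP => big.
by rewrite rE nth_default // in rp; rewrite rp in yp.
Qed.

Lemma next_eq_head y p r : uniq (y :: p) -> r \in p ->
  (y == next (y :: p) r) = (r == last y p).
Proof.
move=> /andP[yp up] rp; rewrite next_nth inE rp orbT /=.
have yr : y != r by apply: contraNneq yp => ->.
rewrite (negPf yr) (last_nth y); have : (index r p < size p)%N by rewrite index_mem.
case sp: (size p) => [|n] //; rewrite ltnS leq_eqVlt /= => /orP[/eqP E|lt].
  by rewrite E nth_default ?sp // eqxx -{1}(nth_index y rp) E eqxx.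
apply/eqP/eqP => [yE|rE].
  by move: yp; rewrite yE mem_nth // sp.
by move: lt; rewrite rE index_uniq ?sp // ltnn.
Qed.

Lemma cyclic_order_index y p q r : cyclic_order e (y :: p) ->
  q \in p -> r \in p -> e q r ->
  index r p = (index q p).+1 \/ index q p = (index r p).+1.
Proof.
move=> [uyp _ ->] qp rp /andP[_].
by rewrite !next_cons_index // => /orP[] /eqP; [left|right].
Qed.

Lemma cyclic_order_mem c q r : cyclic_order e c -> e q r -> (q \in c) && (r \in c).
Proof.
move=> [_ _ ->] /andP[qc]; rewrite qc => /orP[] /eqP E; first by rewrite E mem_next.
by rewrite -(mem_next c r) -E.
Qed.

Lemma cyclic_order_rot n c : cyclic_order e c -> cyclic_order e (rot n c).
Proof.
move=> [uc sc eE]; split; rewrite ?rot_uniq ?size_rot // => q r.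
by rewrite eE mem_rot !next_rot.
Qed.

Lemma cyclic_order_cycle c : cyclic_order e c -> cycle e c.
Proof.
by move=> [uc _ eE]; apply: cycle_from_next => // q qc; rewrite eE qc eqxx.
Qed.

(** Removing [y] and [w] from a cycle leaves two arcs, which contain one
    neighbour of [y] each.  A walk that starts at [a] and avoids [y] changes its
    index by one at every step, so it cannot pass the index of [w]. *)
Lemma cyclic_order_separates (f : rel T) y a p w : cyclic_order e (y :: a :: p) ->
  subrel f e -> (forall q r, f q r -> (r != y) && (r != w)) ->
  w \in a :: p -> w != a -> w != last a p -> ~~ connect f a (last a p).
Proof.
move=> eO fe f_avoid wp wa wb.
have up : uniq (a :: p) by case: eO => /andP[].
have stay p' q : path f q p' -> q \in a :: p ->
    (index q (a :: p) < index w (a :: p))%N ->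
    (index (last q p') (a :: p) < index w (a :: p))%N.
  elim: p' q => [|r p' IH] q // /andP[fqr rp'] qp qw.
  have /andP[ry rw] := f_avoid q r fqr.
  have rp : r \in a :: p.
    have /andP[_] := cyclic_order_mem eO (fe _ _ fqr).
    by rewrite inE (negPf ry).
  apply: (IH r rp' rp); case: (cyclic_order_index eO qp rp (fe _ _ fqr)) => E.
    have : index r (a :: p) != index w (a :: p).
      by apply: contra rw => /eqP/(congr1 (nth a (a :: p))); rewrite !nth_index // => ->.
    move: E qw; move: (index r _) (index q _) (index w _) => k i j.
    by clear; lia.
  move: E qw; move: (index r _) (index q _) (index w _) => k i j.
  by clear; lia.
apply/negP => /connectP[p' ap' bE].
have /(stay _ _ ap') : a \in a :: p by rewrite inE eqxx.
have a_before_w : (index a (a :: p) < index w (a :: p))%N.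
  by rewrite /= eqxx eq_sym (negPf wa).
rewrite -bE index_last // => /(_ a_before_w).
have : index w (a :: p) != size p.
  by apply: contra wb => /eqP E; rewrite -(nth_index a wp) E nth_last.
have : (index w (a :: p) < (size p).+1)%N by rewrite -[(size p).+1]/(size (a :: p)) index_mem.
by move: (index w _) (size p) => k n; clear; lia.
Qed.
End CyclicOrderTheory.

Section ShortCut.
Variables (T : finType) (e : rel T).

(** Following a chord instead of the part of the path between its ends would give
    a path with the same ends that misses the vertices in between. *)
Lemma chordless_of_covering a p q r : path e a p -> uniq (a :: p) ->
  (forall p', path e a p' -> last a p' = last a p -> {subset a :: p <= a :: p'}) ->
  q \in a :: p -> r \in a :: p -> e q r ->
  (index q (a :: p) < index r (a :: p))%N ->
  index r (a :: p) = (index q (a :: p)).+1.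
Proof.
move=> ep up cover qp rp eqr; set P := a :: p in up cover qp rp *.
set i := index q P; set j := index r P => ij.
have jP : (j < size P)%N by rewrite index_mem.
have [j1 jE] : exists j1, j = j1.+1 by case: (j) ij => // j1 _; exists j1.
have dropE : drop j1 p = r :: drop j p.
  by rewrite (drop_nth a) -?jE; 
    [congr cons; rewrite -[RHS](nth_index a rp) -/j jE|move: jP; rewrite jE].
have lastT k : (k < size P)%N -> last a (take k p) = nth a P k.
  move=> kP; rewrite (last_nth a) size_takel //.
  by case: (k) kP => // k' kP; rewrite /= nth_take.
have epj : path e r (drop j p) && (last r (drop j p) == last a p).
  have := ep; rewrite -{1}(cat_take_drop j p) cat_path lastT // nth_index // => /andP[_ ->].
  by rewrite -[in last a p](cat_take_drop j p) last_cat lastT // nth_index //= eqxx.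
have [epj1 /eqP lastj] := andP epj.
have short : path e a (take i p ++ drop j1 p).
  rewrite cat_path lastT ?index_mem // nth_index // dropE /= eqr epj1 !andbT.
  by apply: take_path.
have lshort : last a (take i p ++ drop j1 p) = last a p.
  by rewrite last_cat dropE /= lastj.
apply/eqP; rewrite eqn_leq ij andbT leqNgt; apply/negP => gap.
have iP : (i.+1 < size P)%N by apply: ltn_trans jP.
have := cover _ short lshort (nth a P i.+1) (mem_nth a iP).
have -> : a :: take i p ++ drop j1 p = take i.+1 P ++ drop j P by rewrite jE.
have idx : index (nth a P i.+1) P = i.+1 by rewrite index_uniq.
rewrite mem_cat => /orP[].
  by rewrite in_take ?mem_nth // idx ltnn.
have : uniq (take j P ++ drop j P) by rewrite cat_take_drop.
rewrite cat_uniq => /and3P[_ /hasPn disj _] /disj /negP; apply.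
by rewrite in_take ?mem_nth // idx.
Qed.
End ShortCut.


(** * Cones and links of simplicial chains *)

Section Chains.
Local Open Scope ring_scope.
Variables (T : finType) (F : fieldType).
Local Notation chain := (@chain T F).
Implicit Types (c D : chain) (s t : {set T}) (u v y : T).

Definition face_sign v s : F := (-1) ^+ position v s.

Lemma face_signK v s : face_sign v s * face_sign v s = 1.
Proof. by rewrite /face_sign -expr2 sqrr_sign. Qed.

Lemma face_sign_neq0 v s : face_sign v s != 0.
Proof. by rewrite signr_eq0. Qed.

Lemma position_setU1 v y s : y \notin s ->
  position v (y |: s) = ((enum_rank y < enum_rank v) + position v s)%N.
Proof.
move=> ys; rewrite /position; case: (ltnP (enum_rank y) (enum_rank v)) => yv.
  have -> : [set u in y |: s | (enum_rank u < enum_rank v)%N]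
      = y |: [set u in s | (enum_rank u < enum_rank v)%N].
    apply/setP => u; rewrite !inE; case: (eqVneq u y) => //= ->.
    by rewrite yv.
  by rewrite cardsU1 !inE (negPf ys).
congr #|pred_of_set _|; apply/setP => u; rewrite !inE.
by case: (eqVneq u y) => //= ->; rewrite (negPf ys) /= ltnNge yv.
Qed.

(** Two vertices added to a face in the two possible orders give opposite signs,
    because exactly one of them precedes the other. *)
Lemma face_sign_swap v y s : v != y -> v \notin s -> y \notin s ->
  face_sign y (y |: s) * face_sign v (v |: (y |: s)) =
    - (face_sign v (v |: s) * face_sign y (y |: (v |: s))).
Proof.
move=> vy vs ys; rewrite /face_sign !position_setU1 ?inE ?negb_or ?vs ?ys ?vy 1?eq_sym ?vy //.
rewrite !ltnn !add0n -!exprD addnCA [(position v s + _)%N]addnCA [(position v s + _)%N]addnC.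
case: (ltngtP (enum_rank y) (enum_rank v)) => [_|_|/val_inj/enum_rank_inj yE].
- by rewrite add1n add0n exprS mulN1r.
- by rewrite add1n add0n exprS mulN1r opprK.
- by rewrite yE eqxx in vy.
Qed.

Lemma face_sign_pair u v : u != v -> face_sign v [set u; v] = - face_sign u [set u; v].
Proof.
move=> uv; have sgn1 w : face_sign w [set w] = 1.
  rewrite /face_sign /position.
  have -> : [set x in [set w] | (enum_rank x < enum_rank w)%N] = set0.
    by apply/setP => x; rewrite !inE; case: eqVneq => //= ->; rewrite ltnn.
  by rewrite cards0.
have := @face_sign_swap u v set0 uv; rewrite !inE => /(_ isT isT).
by rewrite !setU0 !sgn1 !mul1r (setUC [set v]) => ->; rewrite opprK.
Qed.

(** The faces with [s] in their boundary are the [v |: s].  The empty face gets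
    coefficient [0] because the boundary is not augmented. *)
Lemma boundary_coef c s : boundary F c s =
  if s == set0 then 0 else \sum_(v | v \notin s) face_sign v (v |: s) * c (v |: s).
Proof.
rewrite boundaryE /boundary_fun sum_ffunE.
have coef t : (c t *: simplex_boundary F t) s =
    \sum_(v in t) (if (s != set0) && (s == t :\ v) then face_sign v t * c t else 0).
  rewrite !ffunE /simplex_boundary; case: ifPn => t1.
    rewrite sum_ffunE [LHS]mulr_sumr; apply: eq_bigr => v vt.
    rewrite !ffunE; case: (eqVneq s (t :\ v)) => [->|]; last first.
      by move=> _; rewrite andbF [_ *: _]mulr0 mulr0.
    rewrite [_ *: _]mulr1 andbT ifT 1?mulrC //.
    rewrite -card_gt0; move: t1; rewrite (cardsD1 v t) vt add1n ltnS; lia.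
  rewrite ffunE scaler0 big1 // => v vt; case: ifP => // /andP[s0 /eqP sE].
  move: s0; rewrite sE -card_gt0; move: t1; rewrite (cardsD1 v t) vt; lia.
under eq_bigr => t _ do rewrite coef.
case: (eqVneq s set0) => [_|s0] /=.
  by rewrite big1 // => t _; rewrite big1.
rewrite (exchange_big_dep xpredT) //= [RHS]big_mkcond; apply: eq_bigr => v _.
case: ifPn => vs.
  rewrite (bigD1 (v |: s)) ?setU11 //= setU1K // eqxx big1 ?addr0 // => t /andP[vt tE].
  by case: eqP => // sE; rewrite sE setD1K // eqxx in tE.
by rewrite big1 // => t vt; case: eqP => // sE; rewrite sE !inE eqxx in vs.
Qed.

Lemma chainsP (X : {set {set T}}) i c :
  reflect (forall s : {set T}, c s != 0 -> s \in X /\ #|s| = i.+1) (c \in chains F X i).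
Proof.
apply: (iffP idP) => [|cX].
  rewrite /chains => /(@coord_span _ _ _ (in_tuple _)) /= -> s.
  rewrite sum_ffunE => nz.
  have [k nzk] : exists k :
      'I_(size [seq simplex_chain F s | s <- enum [set s in X | #|s| == i.+1]]),
      [seq simplex_chain F s | s <- enum [set s in X | #|s| == i.+1]]`_k s != 0.
    apply/existsP; apply: contraNT nz; rewrite negb_exists => /forallP z.
    rewrite big1 // => k _; rewrite ffunE; have := z k; rewrite negbK => /eqP ->.
    exact: mulr0.
  have := mem_nth 0 (ltn_ord k); move: nzk; set d := nth _ _ _ => nzd /mapP[t tX dE].
  move: nzd; rewrite dE ffunE; case: (eqVneq s t) => [->|_]; last by rewrite eqxx.
  by move: tX; rewrite mem_enum inE => /andP[-> /eqP].
have -> : c = \sum_s c s *: simplex_chain F s.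
  apply/ffunP => s; rewrite sum_ffunE (bigD1 s) //= big1 ?addr0.
    by rewrite !ffunE eqxx [RHS]mulr1.
  by move=> t ts; rewrite !ffunE eq_sym (negPf ts) [LHS]mulr0.
apply: memv_suml => s _; have [->|/cX[sX si]] := eqVneq (c s) 0.
  by rewrite scale0r mem0v.
apply/memvZ/memv_span/map_f; by rewrite mem_enum inE sX si eqxx.
Qed.

(** The signs are those with which [s] occurs in the boundary of [y |: s]. *)
Definition cone_chain y c : chain :=
  [ffun t : {set T} => if y \in t then face_sign y t * c (t :\ y) else 0].

Definition link_chain y c : chain :=
  [ffun s : {set T} => if y \in s then 0 else face_sign y (y |: s) * c (y |: s)].

(** Among the faces through [y], removing [y] and another vertex in either order
    has opposite signs, which leaves the boundary of [c] and so [0].  The condition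
    on the support keeps 0-chains out: for them the coefficient of the boundary at the apex is
    the augmentation up to sign, which the unaugmented boundary does not
    control. *)
Lemma boundary_cone_chain y c :
  (forall s : {set T}, c s != 0 -> (1 < #|s|)%N) -> boundary F c = 0 ->
  boundary F (cone_chain y c) = c.
Proof.
move=> c1 cz; have c_small s : (#|s| <= 1)%N -> c s = 0.
  by move=> s1; apply/eqP; apply: contraTT s1 => /c1; rewrite -ltnNge.
apply/ffunP => s; rewrite boundary_coef; case: (eqVneq s set0) => [->|s0].
  by rewrite c_small // cards0.
have [ys|ys] := boolP (y \in s); last first.
  rewrite (bigD1 y) //= ffunE setU11 setU1K // mulrA face_signK mul1r.
  rewrite big1 ?addr0 // => v /andP[vs vy].
  by rewrite ffunE !inE eq_sym (negPf vy) (negPf ys) mulr0.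
pose s' := s :\ y; have ys' : y \notin s' by rewrite !inE eqxx.
have sE : s = y |: s' by rewrite setD1K.
have -> : \sum_(v | v \notin s) face_sign v (v |: s) * cone_chain y c (v |: s) =
    - (face_sign y s * \sum_(v | v \notin s) face_sign v (v |: s') * c (v |: s')).
  rewrite mulr_sumr -sumrN; apply: eq_bigr => v vs.
  have vy : v != y by apply: contraNneq vs => ->.
  have vs' : v \notin s' by rewrite !inE negb_and vs orbT.
  rewrite ffunE !inE ys orbT mulrA.
  have -> : (v |: s) :\ y = v |: s'.
    rewrite setDUl -/s'; congr (_ :|: _); apply/setDidPl.
    by rewrite disjoints1 inE.
  rewrite [in RHS]mulrA -mulNr; congr (_ * _).
  have := face_sign_swap vy vs' ys'; rewrite (setUCA [set y] [set v]) -sE => sw.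
  rewrite -[LHS]mul1r -(face_signK y s) -mulrA [X in _ * X]mulrA sw mulNr.
  by rewrite -[_ * _ * face_sign y (v |: s)]mulrA face_signK mulr1 mulrN.
have [s'0|s'0] := eqVneq s' set0.
  rewrite big1 ?mulr0 ?oppr0 => [|v _].
    by rewrite c_small // sE s'0 setU0 cards1.
  by rewrite c_small ?mulr0 // s'0 setU0 cards1.
have := congr1 (fun d : chain => d s') cz; rewrite boundary_coef (negPf s'0) ffunE.
rewrite (bigD1 y) //= -sE => /eqP; rewrite addrC addr_eq0 => /eqP sumE.
have -> : \sum_(v | v \notin s) face_sign v (v |: s') * c (v |: s') = - (face_sign y s * c s).
  rewrite -sumE; apply: eq_bigl => v; rewrite !inE negb_and negbK andbC.
  by case: (eqVneq v y) => //= ->; rewrite ys.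
by rewrite mulrN opprK mulrA face_signK mul1r.
Qed.

(** Both sides collect the faces obtained from [s] by adding [y] and one more
    vertex; they add the two in opposite orders. *)
Lemma link_boundary_chain y D s : s != set0 ->
  link_chain y (boundary F D) s = - boundary F (link_chain y D) s.
Proof.
move=> s0; rewrite boundary_coef (negPf s0) ffunE.
have [ys|ys] := boolP (y \in s).
  by rewrite big1 ?oppr0 // => v _; rewrite ffunE !inE ys orbT mulr0.
rewrite boundary_coef ifN; last by rewrite -card_gt0 cardsU1 ys.
rewrite [\sum_(v | v \notin s) _](bigD1 y) //= ffunE setU11 mulr0 add0r.
rewrite mulr_sumr -sumrN; apply: eq_big => [v|v vys].
  by rewrite !inE negb_or andbC.
move: vys; rewrite !inE negb_or => /andP[vy vs].
rewrite ffunE !inE eq_sym (negPf vy) (negPf ys) /= mulrA (face_sign_swap vy vs ys).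
by rewrite mulNr mulrA (setUCA [set y]).
Qed.

(** An edge has both ends in [K] or neither, and its boundary has total
    coefficient [0]. *)
Lemma sum_boundary_component (K : pred T) c :
  (forall u v, u != v -> c [set u; v] != 0 -> K u = K v) ->
  \sum_(u | K u) boundary F c [set u] = 0.
Proof.
move=> cK.
pose f u v :=
  if (u != v) && K u && K v then face_sign v [set u; v] * c [set u; v] else 0.
have fN u v : f u v = - f v u.
  rewrite /f eq_sym andbAC setUC; case: ifP; last by rewrite oppr0.
  move=> /andP[/andP[vu _] _]; rewrite -mulNr; congr (_ * _).
  by rewrite (setUC [set v]) face_sign_pair 1?eq_sym.
have f0 u : f u u = 0 by rewrite /f eqxx.
have -> : \sum_(u | K u) boundary F c [set u] = \sum_u \sum_v f u v.
  rewrite big_mkcond; apply: eq_bigr => u _; case: ifPn => Ku; last first.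
    by rewrite big1 // => v _; rewrite /f (negPf Ku) andbF.
  rewrite boundary_coef ifN; last by rewrite -card_gt0 cards1.
  rewrite big_mkcond; apply: eq_bigr => v _; rewrite /f !inE Ku andbT eq_sym.
  case: eqVneq => //= uv; rewrite setUC.
  have [->|/(cK _ _ uv) <-] := eqVneq (c [set u; v]) 0; last by rewrite Ku.
  by rewrite mulr0; case: ifP.
(* In characteristic two, antisymmetry of [f] would not make its sum vanish;
   pairing [f u v] with [f v u] along the vertex order does. *)
have split_f u v : f u v = (if (enum_rank u < enum_rank v)%N then f u v else 0)
    - (if (enum_rank v < enum_rank u)%N then f v u else 0).
  case: (ltngtP (enum_rank u) (enum_rank v)) => [_|_|/val_inj/enum_rank_inj ->].
  - by rewrite subr0.
  - by rewrite sub0r fN.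
  - by rewrite f0 subr0.
under eq_bigr => u _ do under eq_bigr => v _ do rewrite split_f.
under eq_bigr => u _ do rewrite sumrB.
by rewrite sumrB [X in _ - X]exchange_big subrr.
Qed.

(** The sign makes the boundary [r - q], whichever of the two vertices comes
    first in the enumeration. *)
Definition edge_chain q r : chain := face_sign q [set q; r] *: simplex_chain F [set q; r].

Fixpoint walk_chain q (p : seq T) : chain :=
  if p is r :: p' then edge_chain q r + walk_chain r p' else 0.

Lemma boundary_edge_chain q r : q != r ->
  boundary F (edge_chain q r) = simplex_chain F [set r] - simplex_chain F [set q].
Proof.
move=> qr; rewrite /edge_chain linearZ /=.
have -> : boundary F (simplex_chain F [set q; r]) = simplex_boundary F [set q; r].
  rewrite boundaryE /boundary_fun (bigD1 [set q; r]) //= big1 ?addr0.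
    by rewrite ffunE eqxx scale1r.
  by move=> s sE; rewrite ffunE (negPf sE) scale0r.
rewrite /simplex_boundary cards2 qr big_setU1 ?inE //= big_set1.
have -> : [set q; r] :\ q = [set r].
  by apply/setP => u; rewrite !inE; case: (eqVneq u q) => // ->; rewrite (negPf qr).
have -> : [set q; r] :\ r = [set q].
  by apply/setP => u; rewrite !inE; case: (eqVneq u r) => [->|_];
    rewrite ?orbF // eq_sym (negPf qr).
rewrite scalerDr !scalerA -/(face_sign q _) -/(face_sign r _) face_signK scale1r.
have -> : face_sign q [set q; r] * face_sign r [set q; r] = -1; last by rewrite scaleN1r.
by rewrite (face_sign_pair qr) mulrN face_signK.
Qed.

Lemma boundary_walk_chain q p : path (fun u v => u != v) q p ->
  boundary F (walk_chain q p) = simplex_chain F [set last q p] - simplex_chain F [set q].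
Proof.
elim: p q => [|r p IH] q /=; first by rewrite linear0 subrr.
move=> /andP[qr rp]; rewrite linearD /= boundary_edge_chain // IH //.
by rewrite addrC addrA subrK.
Qed.

Lemma edge_chain_neq0 q r s : (edge_chain q r s != 0) = (s == [set q; r]).
Proof.
rewrite !ffunE; case: (s =P [set q; r]) => _; last by rewrite [_ *: _]mulr0 eqxx.
by rewrite [_ *: _]mulr1 face_sign_neq0.
Qed.

Lemma walk_chain_rcons q p r :
  walk_chain q (rcons p r) = walk_chain q p + edge_chain (last q p) r.
Proof.
by elim: p q => [|w p IH] q /=; rewrite ?addr0 ?add0r // IH addrA.
Qed.

Lemma walk_chain_supp (e : rel T) q p s : path e q p -> walk_chain q p s != 0 ->
  exists u v, [/\ u \in q :: p, v \in q :: p, e u v & s = [set u; v]].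
Proof.
elim: p q => [|r p IH] q /=; first by rewrite ffunE eqxx.
move=> /andP[qr rp]; rewrite ffunE.
have [->|nz] := eqVneq (walk_chain r p s) 0.
  rewrite addr0 edge_chain_neq0 => /eqP ->.
  by exists q, r; rewrite !inE !eqxx orbT.
have [u [v [ur vr euv ->]]] := IH r rp nz => _.
by exists u, v; rewrite !(in_cons q) ur vr !orbT.
Qed.
End Chains.


(** * Tightness and paths in vertex links *)

(** The three vertices are required to be distinct; then they span a triangle,
    which is an edge in the links of all three, and the relation is invariant
    under their permutations. *)
Definition link_adj (T : finType) (M : {set {set T}}) : T -> rel T := fun w q r =>
  [&& w != q, w != r, q != r & [set w; q; r] \in M].

Definition link_adj_in (T : finType) (M : {set {set T}}) (B : {set T}) (w : T) : rel T :=
  fun q r => [&& q \in B, r \in B & link_adj M w q r].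

Lemma homology_class_eq0 (T : finType) (F : fieldType) (X : {set {set T}}) i
    (z : cycle_space F X i) :
  (homology_class z == 0)%R = (vsval z \in boundaries F X i).
Proof.
rewrite -boundary_spaceE -(linear0 (vquot_pi (boundary_space F X i))).
by rewrite vquot_piE subr0.
Qed.

Section Tight.
Local Open Scope ring_scope.
Variables (T : finType) (F : fieldType) (M : {set {set T}}).
Hypotheses (Mcx : simplicial_complex M) (Mtight : tight_complex F M).
Implicit Types (B : {set T}) (u v : T).

(** Injectivity on homology, read on chains. *)
Lemma tight_boundaries B i c : B \subset vertices M ->
  c \in cycles F (induced_subcomplex M B) i -> c \in boundaries F M i ->
  c \in boundaries F (induced_subcomplex M B) i.
Proof.
move=> BV cZ cB; have BM : induced_subcomplex M B \subset M.
  by apply/subsetP => s; rewrite inE => /andP[].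
have [_ /(_ B BV i) inj] := Mtight.
pose z := vsproj (cycles F (induced_subcomplex M B) i) c.
have zE : vsval z = c by rewrite vsprojK.
suff /eqP : homology_class z = 0 by rewrite homology_class_eq0 zE.
have class0 : homology_class (0 : cycle_space F (induced_subcomplex M B) i) = 0.
  exact: linear0.
apply: inj; rewrite -class0 !homology_inclE //.
have /eqP -> : homology_class (cycle_incl M z) == 0.
  by rewrite homology_class_eq0 cycle_inclE // zE.
by apply/esym/eqP; rewrite homology_class_eq0 cycle_inclE // linear0 mem0v.
Qed.

Lemma link_adj_sym w q r : link_adj M w q r = link_adj M w r q.
Proof.
by rewrite /link_adj (eq_sym r) (setUAC [set w] [set r]) andbCA.
Qed.

Lemma link_adj_rot w q r : link_adj M w q r = link_adj M q r w.
Proof.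
rewrite /link_adj (eq_sym q w) (eq_sym r w).
have -> : [set q; r; w] = [set w; q; r] by rewrite setUC setUA.
by case: (w != q); case: (w != r); case: (q != r).
Qed.

(** The cycle [v :: a :: p] bounds the cone with apex [u], hence by tightness a
    chain [D] of the subcomplex induced on [B].  The link of [v] in [D] has
    boundary [a - last a p] up to sign, and the coefficients of a boundary sum to
    [0] over every connected component. *)
Lemma tight_link_connected B u v a p : B \subset vertices M -> u \notin B ->
  {subset v :: a :: p <= B} -> uniq (v :: a :: p) -> p != [::] ->
  cycle (link_adj M u) (v :: a :: p) -> connect (link_adj_in M B v) a (last a p).
Proof.
move=> BV uB vapB uq p0 cyc; set b := last a p.
have bp : b \in p by rewrite /b; case: (p) p0 => //= q p' _; apply: mem_last.
have [va [vp [ap up]]] : v != a /\ v \notin p /\ a \notin p /\ uniq p.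
  by move: uq => /=; rewrite inE negb_or => /and3P[/andP[-> ->] -> ->].
have vb : v != b by apply: contraNneq vp => ->.
have ab : a != b by apply: contraNneq ap => ->.
pose c := @walk_chain T F v (rcons (a :: p) v).
have cE : c = edge_chain F v a + walk_chain F a p + edge_chain F b v.
  by rewrite /c /= walk_chain_rcons addrA.
have c_supp s : c s != 0 -> exists q r,
    [/\ q \in B, r \in B, link_adj M u q r & s = [set q; r]].
  move=> /(walk_chain_supp cyc)[q [r [qc rc uqr ->]]]; exists q, r.
  by split=> //; apply: vapB; [move: qc|move: rc];
    rewrite !inE mem_rcons !inE; case: eqVneq => //= _; case: (_ \in p); rewrite ?orbT.
have bc : boundary F c = 0.
  rewrite boundary_walk_chain ?last_rcons ?subrr //.
  by apply: sub_path cyc => q r /and4P[].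
have c1 (s : {set T}) : c s != 0 -> (1 < #|s|)%N.
  by move=> /c_supp[q [r [_ _ /and4P[_ _ qr _] ->]]]; rewrite cards2 qr.
have cZ : c \in cycles F (induced_subcomplex M B) 1.
  rewrite memv_cap memv_ker bc eqxx andbT; apply/chainsP => s.
  move=> /c_supp[q [r [qB rB /and4P[_ _ qr uqr] ->]]]; rewrite cards2 qr; split=> //.
  rewrite inE subUset !sub1set qB rB !andbT.
  by case: Mcx => _; apply; first exact: uqr; rewrite -setUA subsetUr.
(* The cone with apex [u] lies in [M] although [u] is outside [B]. *)
have cB : c \in boundaries F M 1.
  rewrite -(boundary_cone_chain u c1 bc) memv_img //; apply/chainsP => s.
  rewrite ffunE; case: ifPn => [us|]; last by rewrite eqxx.
  rewrite mulf_eq0 negb_or => /andP[_ /c_supp[q [r [qB rB /and4P[uq' ur' qr uqr] sE]]]].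
  rewrite -(setD1K us) sE setUA; split=> //.
  by rewrite -setUA cardsU1 !inE negb_or uq' ur' cards2 qr.
have /memv_imgP[D DC cD] := tight_boundaries BV cZ cB.
have D_supp q r : q != r -> link_chain v D [set q; r] != 0 -> link_adj_in M B v q r.
  move=> qr; rewrite ffunE !inE; case: ifPn => [|vqr]; first by rewrite eqxx.
  rewrite mulf_eq0 negb_or => /andP[_ /(chainsP _ _ _ DC)[]].
  rewrite inE setUA => /andP[vqrM]; rewrite !subUset !sub1set.
  move=> /andP[/andP[_ qB] rB] _; rewrite /link_adj_in qB rB /link_adj qr vqrM.
  by move: vqr; rewrite negb_or => /andP[-> ->].
(* If [last a p] were not in the component [K] of [a], only [a] would contribute
   to the sum over [K] of the boundary of the link of [D]. *)
pose K := connect (link_adj_in M B v) a.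
have symK q r : link_adj_in M B v q r -> K q = K r.
  move=> qr; have rq : link_adj_in M B v r q.
    by move: qr; rewrite /link_adj_in link_adj_sym => /and3P[-> -> ->].
  by apply/idP/idP => h; apply: connect_trans h (connect1 _).
have := sum_boundary_component (K := K) (c := link_chain v D).
move=> /(_ (fun q r qr nz => symK q r (D_supp q r qr nz))) sumK.
have linkE w : boundary F (link_chain v D) [set w] = - link_chain v c [set w].
  by rewrite cD link_boundary_chain ?opprK // -card_gt0 cards1.
(* The edges of the cycle at [v] are the first and the last one. *)
have c_at w : v != w ->
    c [set v; w] = edge_chain F v a [set v; w] + edge_chain F b v [set v; w].
  move=> vw; rewrite cE ffunE; congr (_ + _); rewrite ffunE.
  suff -> : walk_chain F a p [set v; w] = 0 by rewrite addr0.
  apply/eqP; apply/negPn/negP => nz.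
  have pathTT : path (fun _ _ => true) a p by elim: (p) (a) => //=.
  have [q [r [qc rc _ sE]]] := walk_chain_supp pathTT nz.
  have : v \in a :: p.
    have : v \in [set v; w] by rewrite !inE eqxx.
    by rewrite sE !inE => /orP[] /eqP ->.
  by rewrite inE (negPf va) (negPf vp).
have pair_inj w r : v != w -> [set v; w] = [set v; r] -> w = r.
  move=> vw wr; have : w \in [set v; w] by rewrite !inE eqxx orbT.
  by rewrite wr !inE eq_sym (negPf vw) => /eqP.
have link_c w : link_chain v c [set w] != 0 -> w = a \/ w = b.
  rewrite ffunE inE; case: ifPn => [|vw]; first by rewrite eqxx.
  rewrite mulf_eq0 negb_or => /andP[_]; rewrite c_at //.
  have [->|] := eqVneq (edge_chain F v a [set v; w]) 0.
    by rewrite add0r edge_chain_neq0 (setUC [set b]) => /eqP /(pair_inj _ _ vw); right.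
  by rewrite edge_chain_neq0 => /eqP /(pair_inj _ _ vw); left.
have link_ca : link_chain v c [set a] != 0.
  rewrite ffunE inE (negPf va) mulf_neq0 ?face_sign_neq0 // c_at //.
  suff -> : edge_chain F b v [set v; a] = 0 by rewrite addr0 edge_chain_neq0.
  apply/eqP/negPn; rewrite edge_chain_neq0 (setUC [set b]).
  by apply: contra ab => /eqP /(pair_inj _ _ va) ->.
apply/negPn/negP => nKb; move: sumK; rewrite (bigD1 a) /=; last exact: connect0.
rewrite big1 ?addr0 => [/eqP|w /andP[Kw wa]].
  by rewrite linkE oppr_eq0 (negPf link_ca).
rewrite linkE; apply/eqP; rewrite oppr_eq0; apply: contraNT nKb => /link_c[wE|<- //].
by rewrite wE eqxx in wa.
Qed.
End Tight.

(** * Stars of the vertices of the induced subcomplex *)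

Lemma induced_subcomplex_complex (T : finType) (X : {set {set T}}) (A : {set T}) :
  simplicial_complex X -> simplicial_complex (induced_subcomplex X A).
Proof.
move=> [X0 Xdown]; split; first by rewrite inE X0 sub0set.
move=> a b; rewrite !inE => /andP[aX aA] ba.
by rewrite (Xdown a b aX ba) (subset_trans ba aA).
Qed.

(** The star of [v] is the cone over the cycle [s]; it is given by its maximal
    faces. *)
Definition cyclic_star (T : finType) (X : {set {set T}}) (v : T) (s : seq T) :=
  [/\ uniq (v :: s), (2 < size s)%N & forall a : {set T}, v \in a ->
    (a \in X) <-> exists2 q, q \in s & a \subset [set v; q; next s q]].

Lemma cyclic_starI (T : finType) (X : {set {set T}}) (v : T) (s : seq T) :
  simplicial_complex X -> uniq (v :: s) -> (2 < size s)%N ->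
  cycle (link_adj X v) s ->
  (forall q, [set v; q] \in X -> q != v -> q \in s) ->
  (forall q r, link_adj X v q r -> (r == next s q) || (q == next s r)) ->
  (forall a : {set T}, v \in a -> a \in X -> (#|a| <= 3)%N) ->
  cyclic_star X v s.
Proof.
move=> [_ Xdown] uvs ss cyc vert edges dim; split=> // a va; split; last first.
  move=> [q qs asub]; have /and4P[_ _ _ vqX] := next_cycle cyc qs.
  exact: Xdown vqX asub.
move=> aX; have aE : a = v |: (a :\ v) by rewrite setD1K.
have := dim a va aX; rewrite (cardsD1 v a) va add1n ltnS.
have inX q r : q \in a -> r \in a -> [set v; q; r] \in X.
  by move=> qa ra; apply: Xdown aX _; rewrite !subUset !sub1set va qa ra.
have in_s q : q \in a :\ v -> q \in s.
  rewrite !inE => /andP[qv qa]; apply: vert => //.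
  by have := inX q q qa qa; rewrite -setUA setUid.
case: (ltngtP #|a :\ v| 1%N) => [a0|a2|/eqP/cards1P[q qE]] alt.
- have : (0 < size s)%N by lia.
  case: (s) => // q s' _; exists q; first by rewrite inE eqxx.
  have -> : a = [set v].
    by rewrite aE; have /eqP -> : a :\ v == set0; rewrite ?setU0 // -cards_eq0; lia.
  by rewrite sub1set !inE eqxx.
- have /cards2P[q [r [qr qrE]]] : #|a :\ v| == 2 by lia.
  have qav : q \in a :\ v by rewrite qrE !inE eqxx.
  have rav : r \in a :\ v by rewrite qrE !inE eqxx orbT.
  have : link_adj X v q r.
    rewrite /link_adj qr; move: qav rav; rewrite !inE => /andP[qv qa] /andP[rv ra].
    by rewrite inX // eq_sym qv eq_sym rv.
  rewrite aE qrE setUA => /edges/orP[] /eqP E.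
    by exists q; rewrite ?in_s // E.
  by exists r; rewrite ?in_s // E setUAC.
- exists q; first by apply: in_s; rewrite qE inE.
  by rewrite aE qE subsetUl.
Qed.

Section TightStars.
Variables (T : finType) (F : fieldType) (M : {set {set T}}) (x : T) (A : {set T}).
Hypotheses (Mcx : simplicial_complex M) (Mtight : tight_complex F M).
Hypotheses (xM : x \in vertices M) (AM : A \subset vertices M) (xA : x \notin A).
Hypothesis dim_x : forall a : {set T}, x \in a -> a \in M -> a \subset x |: A -> (#|a| <= 3)%N.
Let Y := induced_subcomplex M (x |: A).

Lemma apex_cycle y a p : path (link_adj_in M A y) a p ->
  link_adj M x y a -> link_adj M x (last a p) y -> cycle (link_adj M y) (x :: a :: p).
Proof.
move=> ap xya xby; rewrite /= rcons_path; apply/and3P; split.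
- by rewrite link_adj_sym -link_adj_rot.
- by apply: sub_path ap => q r /and3P[].
- by rewrite link_adj_rot link_adj_rot link_adj_sym.
Qed.

(** Together with [x], a path from [a] to [last a p0] in the link of [y] forms a
    cycle in that link.  Tightness then joins its two ends in the link of [x]
    through vertices of the path; but there [y] and any missing vertex [w] separate
    them. *)
Lemma path_covers y a p0 p : cyclic_order (link_adj_in M A x) (y :: a :: p0) ->
  y :: a :: p0 =i A -> path (link_adj_in M A y) a p -> last a p = last a p0 ->
  forall w, w \in A -> w != y -> w \in a :: p.
Proof.
move=> cO cA ap lp w wA wy; have [/= uc sc _] := cO.
move: uc; rewrite inE negb_or => /and3P[/andP[ya yp0] ap0 up0].
have p00 : p0 != [::] by move: sc; case: (p0).
have lp0 : last a p0 \in p0 by case: (p0) p00 => //= r p' _; apply: mem_last.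
have ab : a != last a p0 by apply: contraNneq ap0 => ->.
have := cyclic_order_cycle cO; rewrite /= rcons_path =>
  /and3P[/and3P[yA aA ya_tri] _ /and3P[bA _ by_tri]].
case/shortenP: ap lp => p' ap' up' sub lp'.
suff : w \in a :: p' by rewrite !inE => /orP[->//|/sub ->]; rewrite orbT.
apply: contraT => wp'.
have sub_A z : z \in p' -> (z \in A) && (z != y).
  elim: (p') (a) ap' => //= r p1 IH z0 /andP[/and3P[_ rA /and4P[_ yr _ _]] /IH rp1].
  by rewrite inE => /orP[/eqP ->|/rp1 //]; rewrite rA eq_sym.
pose B := x |: [set z in a :: p'].
have : connect (link_adj_in M B x) a (last a p').
  apply: (@tight_link_connected T F M Mcx Mtight B y x a p').
  - rewrite subUset sub1set xM; apply/subsetP => z; rewrite !inE.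
    move=> /orP[/eqP ->|/sub_A/andP[zA _]].
      by have := subsetP AM _ aA; rewrite inE.
    by have := subsetP AM _ zA; rewrite inE.
  - rewrite !inE !negb_or ya andbC; apply/andP; split.
      by apply/negP => /sub_A; rewrite eqxx andbF.
    by apply: contraNneq xA => <-.
  - by move=> z; rewrite !inE.
  - rewrite -[uniq _]/((x \notin a :: p') && uniq (a :: p')) up' andbT inE negb_or.
    apply/andP; split; first by apply: contraNneq xA => ->.
    by apply/negP => /sub_A; rewrite (negPf xA).
  - by apply: contraNneq ab => p'0; rewrite -lp' p'0.
  - by apply: apex_cycle ap' ya_tri _; rewrite lp'.
rewrite lp'; apply: contraTT => _.
apply: (cyclic_order_separates cO (f := link_adj_in M B x) (w := w)).
- move=> q r /and3P[qB rB xqr]; have [xq xr] : x != q /\ x != r by case/and4P: xqr.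
  have B_A z : z \in B -> x != z -> z \in A.
    rewrite !inE => /or3P[/eqP ->|/eqP ->|/sub_A/andP[]] //; by rewrite eqxx.
  by rewrite /link_adj_in !B_A.
- move=> q r /and3P[_ + /and4P[_ xr _ _]]; rewrite !inE eq_sym (negPf xr) /= => rp.
  apply/andP; split; last by apply: contraNneq wp' => <-; rewrite inE.
  case/orP: rp => [/eqP ->|/sub_A/andP[] //]; by rewrite eq_sym.
- by have := cA w; rewrite inE (negPf wy) wA.
- by apply: contraNneq wp' => ->; rewrite inE eqxx.
- by apply: contraNneq wp' => ->; rewrite -lp' mem_last.
Qed.

Let Ycx : simplicial_complex Y. Proof. exact: induced_subcomplex_complex. Qed.

Let Y_vertex v q : [set v; q] \in Y -> q \in x |: A.
Proof. by rewrite inE subUset !sub1set => /andP[_ /andP[]]. Qed.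

Let induced_link_adj v q r : link_adj Y v q r ->
  [/\ link_adj M v q r, q \in x |: A & r \in x |: A].
Proof.
rewrite /link_adj inE !subUset !sub1set.
by move=> /and4P[-> -> -> /andP[-> /andP[/andP[_ ->] ->]]].
Qed.

Let induced_link_cycle v s : v \in x |: A -> {subset s <= x |: A} -> cycle (link_adj M v) s ->
  cycle (link_adj Y v) s.
Proof.
move=> vA sA; apply: (sub_in_cycle (P := mem (x |: A))); last exact/allP.
move=> q r qA rA /and4P[vq vr qr vqr]; rewrite /link_adj vq vr qr inE vqr.
by rewrite !subUset !sub1set vA qA rA.
Qed.

Lemma apex_star c : cyclic_order (link_adj_in M A x) c -> c =i A -> cyclic_star Y x c.
Proof.
move=> cO cA; have [uc sc eE] := cO; have cyc := cyclic_order_cycle cO.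
have not_x q : q \in x |: A -> x != q -> q \in A.
  by rewrite !inE => /orP[/eqP ->|//]; rewrite eqxx.
apply: cyclic_starI => //.
- by rewrite /= uc cA xA.
- apply: induced_link_cycle; first exact: setU11.
    by move=> q qc; rewrite !inE -cA qc orbT.
  by apply: sub_cycle cyc => q r /and3P[].
- by move=> q /Y_vertex qA qx; rewrite cA not_x // eq_sym.
- move=> q r /induced_link_adj[xqr qA rA]; have /and4P[xq xr _ _] := xqr.
  have : link_adj_in M A x q r by rewrite /link_adj_in !not_x.
  by rewrite eE => /andP[].
- by move=> a xa; rewrite inE => /andP[aM aA]; apply: dim_x.
Qed.

(** The neighbours [a] and [last a p0] of [y] on the cycle are joined by a path in
    the link of [y].  By [path_covers] no vertex of it can be bypassed, so it has
    no chords, and it closes up through [x], whose neighbours in this link are the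
    two ends. *)
Lemma base_star c y : cyclic_order (link_adj_in M A x) c -> c =i A -> y \in A ->
  exists s, cyclic_star Y y s.
Proof.
move=> cO cA yA; have [i c' cE] : rot_to_spec c y by apply: rot_to; rewrite cA.
have {}cO := cyclic_order_rot i cO; have {}cA : rot i c =i A by move=> z; rewrite mem_rot cA.
move: cO cA; rewrite {}cE; case: c' => [|a p0] cO cA; first by case: cO.
have [/= uc sc eE] := cO.
move: uc; rewrite inE negb_or => /and3P[/andP[ya yp0] ap0 up0].
have p00 : p0 != [::] by move: sc; case: (p0).
have lp0 : last a p0 \in p0 by case: (p0) p00 => //= r p' _; apply: mem_last.
have ab : a != last a p0 by apply: contraNneq ap0 => ->.
have cyc := cyclic_order_cycle cO.
have aA : a \in A by rewrite -cA !inE eqxx orbT.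
have [xya xby] : link_adj M x y a /\ link_adj M x (last a p0) y.
  by move: cyc; rewrite /= rcons_path => /and3P[/and3P[_ _ ->] _ /and3P[_ _ ->]].
have xy : x != y by apply: contraNneq xA => ->.
have : connect (link_adj_in M A y) a (last a p0).
  apply: (@tight_link_connected T F M Mcx Mtight A x y a p0) => //.
  - by move=> z zc; rewrite -cA.
  - by case: cO.
  - by apply: sub_cycle cyc => q r /and3P[].
move=> /connectP[p1 ap1 /esym lp1]; case/shortenP: ap1 lp1 => p ap up _ lp {p1}.
have cover := path_covers cO cA.
have coverA z : z \in A -> z != y -> z \in a :: p := cover p ap lp z.
have p_sub z : z \in a :: p -> (z \in A) && (z != y).
  rewrite inE => /orP[/eqP ->|]; first by rewrite aA eq_sym.
  elim: (p) (a) ap => //= r p1 IH z0 /andP[/and3P[_ rA /and4P[_ yr _ _]] /IH rp1].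
  by rewrite inE => /orP[/eqP ->|/rp1 //]; rewrite rA eq_sym.
have consec q r : link_adj_in M A y q r ->
    index r (a :: p) = (index q (a :: p)).+1 \/ index q (a :: p) = (index r (a :: p)).+1.
  move=> yqr; have /and3P[qA rA /and4P[yq yr qr _]] := yqr.
  have yrq : link_adj_in M A y r q.
    by move: yqr; rewrite /link_adj_in link_adj_sym => /and3P[-> -> ->].
  have qp : q \in a :: p by apply: coverA; rewrite // eq_sym.
  have rp : r \in a :: p by apply: coverA; rewrite // eq_sym.
  have cov p' : path (link_adj_in M A y) a p' ->
      last a p' = last a p -> {subset a :: p <= a :: p'}.
    by move=> ap' lp' z /p_sub/andP[zA zy]; apply: (cover p') => //; rewrite lp'.
  have chordless := chordless_of_covering ap up cov.
  case: (ltngtP (index q (a :: p)) (index r (a :: p))) => [lt|lt|E].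
  - by left; apply: chordless.
  - by right; apply: chordless.
  - by move: qr; rewrite -(nth_index a qp) E nth_index // eqxx.
have p_neq0 : p != [::] by apply: contraNneq ab => p0E; rewrite -lp p0E.
have us : uniq (x :: a :: p).
  rewrite cons_uniq up andbT; apply/negP => /p_sub; by rewrite (negPf xA).
(* Adjacency of [x] and [r] in the link of [y] is adjacency of [y] and [r] in the
   link of [x], which the cyclic order describes. *)
have link_x r : link_adj M y x r -> r \in A ->
    (r == next (x :: a :: p) x) || (x == next (x :: a :: p) r).
  move=> yxr rA; have rx : r != x by apply: contraNneq xA => <-.
  have ry : r != y by case/and4P: yxr => _ yr _ _; rewrite eq_sym.
  have rp : r \in a :: p by apply: coverA.
  have : link_adj_in M A x y r.
    by rewrite /link_adj_in yA rA -link_adj_rot -link_adj_rot link_adj_sym.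
  have rp0 : r \in a :: p0 by have := cA r; rewrite inE (negPf ry) rA.
  rewrite eE => /andP[_]; rewrite (next_eq_head _ rp) // (next_eq_head _ rp0); last by case: cO.
  by rewrite /= !eqxx lp.
exists (x :: a :: p); apply: cyclic_starI => //.
- rewrite cons_uniq us andbT inE negb_or eq_sym xy /=; apply/negP => /p_sub.
  by rewrite eqxx andbF.
- by case: (p) p_neq0.
- apply: induced_link_cycle; first by rewrite !inE yA orbT.
    by move=> z; rewrite inE => /orP[/eqP ->|/p_sub/andP[zA _]]; rewrite !inE ?eqxx ?zA ?orbT.
  by apply: apex_cycle; rewrite ?lp.
- move=> q /Y_vertex; rewrite in_setU1 in_cons => /orP[->//|qA] qy.
  by rewrite coverA ?orbT.
- move=> q r /induced_link_adj[yqr]; have /and4P[yq yr qr _] := yqr.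
  rewrite !inE => /orP[/eqP qx|qA] /orP[/eqP rx|rA].
  + by rewrite qx rx eqxx in qr.
  + by rewrite qx; apply: link_x; rewrite -?qx.
  + by rewrite orbC rx; apply: link_x; rewrite -?rx // link_adj_sym.
  have yqr' : link_adj_in M A y q r by rewrite /link_adj_in qA rA.
  rewrite !next_cons_index ?coverA // 1?eq_sym //.
  by case: (consec _ _ yqr') => ->; rewrite eqxx ?orbT.
move=> f yf; rewrite inE => /andP[fM fA]; have [xf|xf] := boolP (x \in f).
  exact: dim_x.
rewrite leqNgt; apply/negP => f4.
(* Three more vertices would have pairwise consecutive indices on the path. *)
have /card_gt2P[q [r [w [[qf rf wf] [qr rw wq]]]]] : (2 < #|f :\ y|)%N.
  by move: f4; rewrite (cardsD1 y f) yf.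
have in_A z : z \in f :\ y -> [/\ z \in A, z != y & z \in f].
  rewrite !inE => /andP[-> zf]; split=> //; have := subsetP fA z zf.
  by rewrite !inE => /orP[/eqP zx|//]; rewrite -zx zf in xf.
have tri_f z1 z2 : z1 \in f :\ y -> z2 \in f :\ y -> z1 != z2 -> link_adj_in M A y z1 z2.
  move=> /in_A[A1 y1 f1] /in_A[A2 y2 f2] z12; rewrite /link_adj_in A1 A2 /link_adj z12.
  rewrite eq_sym y1 eq_sym y2 /=; have [_ Mdown] := Mcx; apply: Mdown fM _.
  by rewrite !subUset !sub1set yf f1 f2.
have := consec _ _ (tri_f _ _ qf rf qr); have := consec _ _ (tri_f _ _ rf wf rw).
have := consec _ _ (tri_f _ _ wf qf wq).
by move: (index q _) (index r _) (index w _) => iq ir iw; clear; lia.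
Qed.
End TightStars.

(** * A complete fan in the plane *)

Section RealContinuity.
Local Open Scope ring_scope.
Variables (R : realType) (S : topologicalType).
Implicit Types f g : S -> R.

Lemma continuous_addr f g :
  continuous f -> continuous g -> continuous (fun s => f s + g s).
Proof. by move=> cf cg s; apply: cvgD; [apply: cf|apply: cg]. Qed.

Lemma continuous_subr f g :
  continuous f -> continuous g -> continuous (fun s => f s - g s).
Proof. by move=> cf cg s; apply: cvgB; [apply: cf|apply: cg]. Qed.

Lemma continuous_scaler (a : R) f :
  continuous f -> continuous (fun s => a * f s).
Proof. by move=> cf s; apply: cvgM; [apply: cvg_cst|apply: cf]. Qed.

Lemma continuous_maxr f g :
  continuous f -> continuous g -> continuous (fun s => Num.max (f s) (g s)).
Proof.
by move=> cf cg s; apply: (@continuous_max _ _ f g s); [apply: cf|apply: cg].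
Qed.

Lemma continuous_sumr (I : Type) (r : seq I) (f : I -> S -> R) :
  (forall i, continuous (f i)) -> continuous (fun s => \sum_(i <- r) f i s).
Proof.
move=> cf; have := @continuous_big R I +%R 0 xpredT (@add_continuous R) S r f.
by apply=> i _; apply: cf.
Qed.

Lemma continuous_pairr f g :
  continuous f -> continuous g -> continuous (fun s => (f s, g s)).
Proof.
move=> cf cg s. exact: (cvg_pair (cf s) (cg s)). Qed.
End RealContinuity.

Section Fan.
Local Open Scope ring_scope.
Variables (R : realType) (m : nat).
Hypothesis m_gt0 : (0 < m)%N.

(** The rays of the fan are generated by [(1, k)] for [k <= m] and by
    [(-2, -m)], the opposite of the sum of [(1, 0)] and [(1, m)]; [w k] is the
    weight of the [k]-th generator.  With [0 < m] the last ray is opposite to the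
    interior of the cone spanned by the others, and the fan is complete. *)
Definition fan_point (w : nat -> R) : R * R :=
  (\sum_(i < m.+1) w i - 2 * w m.+1,
   \sum_(i < m.+1) i%:R * w i - m%:R * w m.+1).

(** The coordinate of [z] on the last ray: the least [t >= 0] such that
    [z + t (2, m)] lies in the cone [0 <= y <= m x] spanned by the other rays. *)
Definition fan_depth (z : R * R) : R :=
  Num.max 0 (Num.max (- z.2) (z.2 - m%:R * z.1)) / m%:R.

(** The coordinates of [z] in the fan.  Moving [z] along [(2, m)] by its depth
    removes the last coordinate; on the cone of the other rays the [k]-th
    coordinate is the tent function with slope break at [y = k x]. *)
Definition fan_hat (z : R * R) (i : nat) : R :=
  let x := z.1 + 2 * fan_depth z in
  let y := z.2 + m%:R * fan_depth z in
  if i == m.+1 then fan_depth z else Num.max 0 (x - `|y - i%:R * x|).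

(** Cyclic adjacency of the [m + 2] rays, with [i < j]. *)
Definition fan_adj (i j : nat) :=
  ((j == i.+1) && (i <= m)%N) || ((i == 0%N) && (j == m.+1)).

Definition fan_supported (w : nat -> R) (i j : nat) :=
  (forall k, 0 <= w k) /\ forall k, (k <= m.+1)%N -> k != i -> k != j -> w k = 0.

Lemma fan_pointE w i j : (i < j <= m.+1)%N -> fan_supported w i j ->
  fan_point w =
  if j == m.+1 then (w i - 2 * w j, i%:R * w i - m%:R * w j)
  else (w i + w j, i%:R * w i + j%:R * w j).
Proof.
move=> /andP[ij jm] [_ w0]; rewrite /fan_point.
have im : (i < m.+1)%N by lia.
have sumE (F : nat -> R) : \sum_(k < m.+1) F k * w k =
    F i * w i + (if j == m.+1 then 0 else F j * w j).
  rewrite (bigD1 (Ordinal im)) //=; congr (_ + _).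
  case: eqP => [jE|/eqP jE].
    apply: big1 => k ki; rewrite w0 ?mulr0 //; first by rewrite ltnW.
    by rewrite jE; have := ltn_ord k; lia.
  have jm' : (j < m.+1)%N by lia.
  rewrite (bigD1 (Ordinal jm')) //=; last by rewrite -val_eqE /=; lia.
  rewrite big1 ?addr0 // => k /andP[ki kj].
  by rewrite w0 ?mulr0 //; rewrite ltnW.
have -> : \sum_(k < m.+1) w k = \sum_(k < m.+1) (fun=> 1) (k : nat) * w k.
  by apply: eq_bigr => k _; rewrite mul1r.
rewrite (sumE (fun=> 1)) (sumE (fun k => k%:R)) !mul1r.
case: eqP => [->|/eqP jE]; first by rewrite !addr0.
by rewrite (w0 m.+1) ?mulr0 ?subr0 //; lia.
Qed.

Let mR : 0 < m%:R :> R. Proof. by rewrite ltr0n. Qed.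

Lemma fan_depthE z t : m%:R * t = Num.max 0 (Num.max (- z.2) (z.2 - m%:R * z.1)) ->
  fan_depth z = t.
Proof. by rewrite /fan_depth => <-; rewrite [m%:R * t]mulrC mulfK // gt_eqF. Qed.

(** The three cases are a sector between two consecutive rays [(1, i)], and the
    two sectors on the sides of the last ray. *)
Lemma fan_hatK w i j : fan_adj i j -> fan_supported w i j ->
  forall k, (k <= m.+1)%N -> fan_hat (fan_point w) k = w k.
Proof.
move=> adj sw k km; have [w_ge0 w0] := sw.
have ijm : (i < j <= m.+1)%N by move: adj; rewrite /fan_adj; lia.
rewrite (fan_pointE ijm sw).
have wk : w k = if k == i then w i else if k == j then w j else 0.
  by case: eqP => [->//|/eqP ki]; case: eqP => [->//|/eqP kj]; apply: w0.
rewrite wk; have := w_ge0 i; have := w_ge0 j.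
move: (w i) (w j) => c d d0 c0 {wk w0 w_ge0 sw}.
case: eqP => [jE|/eqP jE].
  have mc : 0 <= m%:R * c by rewrite mulr_ge0.
  have md : 0 <= m%:R * d by rewrite mulr_ge0.
  have depthE : fan_depth (c - 2 * d, i%:R * c - m%:R * d) = d.
    apply: fan_depthE => /=.
    have [->|->] : i = m \/ i = 0%N by move: adj; rewrite /fan_adj; lia.
      by rewrite [X in Num.max 0 X]max_r; [rewrite max_r; [ring|lra]|lra].
    by rewrite [X in Num.max 0 X]max_l; [rewrite max_r; [ring|lra]|lra].
  rewrite /fan_hat depthE /= jE.
  case: (eqVneq k m.+1) => [->|km1]; first by rewrite ifN //; lia.
  have -> : c - 2 * d + 2 * d = c by ring.
  have -> : i%:R * c - m%:R * d + m%:R * d = i%:R * c by ring.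
  rewrite -mulrBl normrM (ger0_norm c0).
  case: eqP => [->|/eqP ki]; first by rewrite subrr normr0 mul0r subr0 max_r.
  have : 1 <= `|i%:R - k%:R : R|.
    have [ik|ki'] := ltnP i k.
      rewrite distrC ger0_norm ?subr_ge0 ?ler_nat 1?ltnW //.
      by rewrite lerBrDl natr1 ler_nat; lia.
    rewrite ger0_norm ?subr_ge0 ?ler_nat //.
    by rewrite lerBrDl natr1 ler_nat; lia.
  move=> h; rewrite max_l //; nra.
have [jE' im] : j = i.+1 /\ (i.+1 <= m)%N by move: adj; rewrite /fan_adj; lia.
have iR : i%:R + 1 <= m%:R :> R by rewrite natr1 ler_nat.
have i0 : 0 <= i%:R :> R by [].
rewrite {}jE' -[i.+1]addn1 natrD.
have depthE : fan_depth (c + d, i%:R * c + (i%:R + 1) * d) = 0.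
  apply: fan_depthE => /=; rewrite mulr0 max_l // ge_max; apply/andP; split; nra.
rewrite /fan_hat depthE /= !mulr0 !addr0.
case: eqP => [->|_]; first by rewrite !ifN //; lia.
have -> : i%:R * c + (i%:R + 1) * d - k%:R * (c + d)
   = (i%:R - k%:R) * c + (i%:R + 1 - k%:R) * d by ring.
case: eqP => [->|/eqP ki].
  have -> : (i%:R - i%:R) * c + (i%:R + 1 - i%:R) * d = d by ring.
  by rewrite ger0_norm // addrK max_r.
case: eqP => [->|/eqP kj].
  rewrite natrD.
  have -> : (i%:R - (i%:R + 1)) * c + (i%:R + 1 - (i%:R + 1)) * d = - c by ring.
  by rewrite normrN ger0_norm // addrAC subrr add0r max_r.
have [ik|ki'] := ltnP i k.
  have : i%:R + 2 <= k%:R :> R by rewrite -natrD ler_nat; lia.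
  move=> h; rewrite max_l // subr_le0 ler0_norm; nra.
have : k%:R + 1 <= i%:R :> R by rewrite natr1 ler_nat; lia.
by move=> h; rewrite max_l // subr_le0 ger0_norm; nra.
Qed.

Definition spikes (i j : nat) (c d : R) (k : nat) : R :=
  if k == i then c else if k == j then d else 0.

Lemma fan_spikes i j c d : 0 <= c -> 0 <= d -> fan_supported (spikes i j c d) i j.
Proof.
move=> c0 d0; rewrite /spikes; split=> k.
  by case: ifP => // _; case: ifP.
by move=> _ /negPf -> /negPf ->.
Qed.

(** The sectors cover the plane.  A point outside the cone [0 <= y <= m x] lies in
    a sector at the last ray, namely the one next to the side of the cone that it
    violates most; a point inside the cone lies in the sector determined by
    rounding down [y / x]. *)
Lemma fan_point_surj z : exists w i j,
  [/\ fan_adj i j, fan_supported w i j & fan_point w = z].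
Proof.
suff [i [j [c [d [adj c0 d0 zE]]]]] : exists i j c d, [/\ fan_adj i j, 0 <= c, 0 <= d &
    z = if j == m.+1 then (c - 2 * d, i%:R * c - m%:R * d)
        else (c + d, i%:R * c + j%:R * d)].
  exists (spikes i j c d), i, j; split=> //; first exact: fan_spikes.
  have ijm : (i < j <= m.+1)%N by move: adj; rewrite /fan_adj; lia.
  rewrite (fan_pointE ijm (fan_spikes _ _ c0 d0)) zE /spikes !eqxx.
  by rewrite (_ : (j == i) = false) //; lia.
case: z => x y.
have [y_lt0|y_ge0] := ltP y 0; have [yx|yx] := ltP (m%:R * x) y.
- have [h|h] := leP (- y) (y - m%:R * x).
    exists m, m.+1, (x + 2 * ((y - m%:R * x) / m%:R)), ((y - m%:R * x) / m%:R).
    rewrite /fan_adj !eqxx leqnn.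
    split=> //.
    + rewrite -(pmulr_rge0 _ mR).
      have -> : m%:R * (x + 2 * ((y - m%:R * x) / m%:R)) = 2 * y - m%:R * x.
        by field; rewrite gt_eqF.
      lra.
    + by rewrite divr_ge0 // ?ltW //; lra.
    + by congr pair; field; rewrite gt_eqF.
  exists 0%N, m.+1, (x + 2 * (- y / m%:R)), (- y / m%:R).
  rewrite /fan_adj !eqxx orbT.
  split=> //.
  + rewrite -(pmulr_rge0 _ mR).
    have -> : m%:R * (x + 2 * (- y / m%:R)) = m%:R * x - 2 * y.
      by field; rewrite gt_eqF.
    lra.
  + by rewrite divr_ge0 // ?ltW //; lra.
  + by congr pair; field; rewrite gt_eqF.
- exists 0%N, m.+1, (x + 2 * (- y / m%:R)), (- y / m%:R).
  rewrite /fan_adj !eqxx orbT.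
  split=> //.
  + rewrite -(pmulr_rge0 _ mR).
    have -> : m%:R * (x + 2 * (- y / m%:R)) = m%:R * x - 2 * y.
      by field; rewrite gt_eqF.
    lra.
  + by rewrite divr_ge0 // ?ltW //; lra.
  + by congr pair; field; rewrite gt_eqF.
- exists m, m.+1, (x + 2 * ((y - m%:R * x) / m%:R)), ((y - m%:R * x) / m%:R).
  rewrite /fan_adj !eqxx leqnn.
  split=> //.
  + rewrite -(pmulr_rge0 _ mR).
    have -> : m%:R * (x + 2 * ((y - m%:R * x) / m%:R)) = 2 * y - m%:R * x.
      by field; rewrite gt_eqF.
    lra.
  + by rewrite divr_ge0 // ?ltW //; lra.
  + by congr pair; field; rewrite gt_eqF.
have x_ge0 : 0 <= x by rewrite -(pmulr_rge0 _ mR); lra.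
have [i [im iy yi]] : exists i, [/\ (i < m)%N, i%:R * x <= y & y <= (i%:R + 1) * x].
  have ex : exists k, y <= k.+1%:R * x by exists m.-1; rewrite prednK.
  exists (ex_minn ex); case: ex_minnP => i yi min_i; split.
  + by have := min_i m.-1; rewrite prednK // => /(_ yx); lia.
  + case: i min_i {yi} => [|i] min_i; first by rewrite mul0r.
    by rewrite leNgt; apply/negP => /ltW /min_i; rewrite ltnn.
  + by rewrite natr1.
exists i, i.+1, ((i%:R + 1) * x - y), (y - i%:R * x).
rewrite /fan_adj eqxx (ltnW im) ifN; last by lia.
split=> //; [lra|lra|].
by rewrite -natr1; congr pair; ring.
Qed.

Lemma fan_pointK z : fan_point (fan_hat z) = z.
Proof.
have [w [i [j [adj sw <-]]]] := fan_point_surj z.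
rewrite {1}/fan_point; congr pair; rewrite !(fan_hatK adj sw) //.
  congr (_ - _); apply: eq_bigr => k _; rewrite (fan_hatK adj sw) //.
  by rewrite ltnW // ltnW.
congr (_ - _); apply: eq_bigr => k _; rewrite (fan_hatK adj sw) //.
by rewrite ltnW // ltnW.
Qed.

Lemma fan_hat_ge0 z k : (k <= m.+1)%N -> 0 <= fan_hat z k.
Proof.
have [w [i [j [adj sw <-]]]] := fan_point_surj z => km.
by rewrite (fan_hatK adj sw) //; case: sw.
Qed.

Lemma fan_hat_supp z : exists i j, fan_adj i j /\
  forall k, (k <= m.+1)%N -> k != i -> k != j -> fan_hat z k = 0.
Proof.
have [w [i [j [adj sw <-]]]] := fan_point_surj z.
exists i, j; split=> // k km ki kj.
by rewrite (fan_hatK adj sw) //; case: sw => _; apply.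
Qed.

Lemma fan_hat_continuous k : continuous (fun z => fan_hat z k).
Proof.
have c1 : continuous (fun z : R * R => z.1) by move=> z; exact: cvg_fst.
have c2 : continuous (fun z : R * R => z.2) by move=> z; exact: cvg_snd.
have cdepth : continuous fan_depth.
  have -> : fan_depth = fun z => m%:R^-1 * Num.max 0 (Num.max (- z.2) (z.2 - m%:R * z.1)).
    by apply/funext => z; rewrite mulrC.
  apply: continuous_scaler; apply: continuous_maxr; first by move=> z; apply: cvg_cst.
  apply: continuous_maxr; first by move=> z; apply: cvgN; apply: c2.
  by apply: continuous_subr => //; apply: continuous_scaler.
rewrite /fan_hat; case: (k == m.+1) => //.
apply: continuous_maxr; first by move=> z; apply: cvg_cst.
have cx : continuous (fun z : R * R => z.1 + 2 * fan_depth z).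
  by apply: continuous_addr => //; apply: continuous_scaler.
apply: continuous_subr => // z.
apply: (@cvg_norm _ _ _ _ _
  (fun z => z.2 + m%:R * fan_depth z - k%:R * (z.1 + 2 * fan_depth z))).
move: z; apply: continuous_subr; last exact: continuous_scaler.
by apply: continuous_addr => //; apply: continuous_scaler.
Qed.
End Fan.

(** * Topology of the carrier *)

Section Subtypes.
Local Open Scope classical_set_scope.
Lemma set_val_continuous (S : topologicalType) (A : set S) :
  continuous (set_val : A -> S).
Proof. exact: initial_continuous. Qed.

Lemma continuous_to_subtype (S S' : topologicalType) (A : set S) (f : S' -> A) :
  continuous (fun s => set_val (f s)) -> continuous f.
Proof.
move=> /continuousP cf; apply/continuousP => U [V oV <-].
exact: (cf V oV).
Qed.

Lemma compact_subtype (S : topologicalType) (A : set S) :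
  compact A -> compact [set: A].
Proof.
move=> cA F PF _.
have [|s [As clF]] := cA (set_val @ F) (fmap_proper_filter _ PF).
  by apply: nearW => s; apply: set_valP.
exists (SigSub (mem_set As)); split=> // P Q FP /= [_ [[V oV <-] /= Vs VQ]].
have FP' : (set_val @ F) (set_val @` P).
  by apply: (filterS (P := P)) FP => t Pt; exists t.
have [_ [[t Pt <-] Vt]] := clF _ V FP' (open_nbhs_nbhs (conj oV Vs)).
by exists t; split=> //; apply: VQ.
Qed.

Lemma hausdorff_subtype (S : topologicalType) (A : set S) :
  hausdorff_space S -> hausdorff_space A.
Proof.
move=> hS s t clst; apply/val_inj/hS => P Q /= sP tQ.
have [r [Pr Qr]] := clst (set_val @^-1` P) (set_val @^-1` Q)
  (set_val_continuous sP) (set_val_continuous tQ).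
by exists (set_val r).
Qed.

(** The result for pointed spaces applies as soon as there is a point, and the
    empty space has the empty basis. *)
Lemma compact_pseudometric_second_countable (R : realType)
    (S : pseudoMetricType R) : compact [set: S] -> second_countable (T := S).
Proof.
move=> cS; have [[p _]|no_p] := pselect (exists p : S, True).
  pose P := HB.pack_for (pseudoPMetricType R) (PseudoMetric.sort S)
    (isPointed.Build (PseudoMetric.sort S) p).
  exact: (@compact_second_countable R P cS).
exists classical_sets.set0; first exact: countable0.
by split=> // p; case: no_p; exists p.
Qed.

Lemma compact_subtype_second_countable (R : realType)
    (S : pseudoMetricType R) (A : set S) : compact A -> second_countable (T := A).
Proof.
by move=> /compact_subtype cA; apply: compact_pseudometric_second_countable cA.
Qed.
End Subtypes.

Section Carrier.
Local Open Scope classical_set_scope.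
Local Open Scope ring_scope.
Variable R : realType.
Variable T : finType.
Local Notation pts := {ptws T -> R}.

Lemma coord_continuous (v : T) : continuous (fun p : pts => p v).
Proof. exact: (@proj_continuous T (fun=> R) v). Qed.

Lemma coords_continuous (S : topologicalType) (f : S -> pts) :
  (forall v, continuous (fun s => f s v)) -> continuous f.
Proof.
move=> cf s; apply/cvg_sup => v; move: s.
apply/(@continuousP _ (initial_topology (fun p : pts => p v))) => A [B oB <-].
by move/continuousP: (cf v) => /(_ B oB).
Qed.

(** Because a subset of a face is a face, the condition on the support says that
    for one of the finitely many faces [a] all coordinates outside [a] vanish. *)
Lemma carrier_closed (X : {set {set T}}) :
  simplicial_complex X -> closed (carrier (R := R) X).
Proof.
move=> [_ Xdown].
have -> : carrier X = \bigcap_(v in [set: T]) [set p : pts | 0 <= p v] `&`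
    ([set p : pts | \sum_v p v = 1] `&`
     \bigcup_(a in [set` X]) \bigcap_(v in [set v | v \notin a]) [set p : pts | p v = 0]).
  apply/seteqP; split=> p.
    move=> [p0 p1 pX]; split=> [v _|]; first exact: p0.
    split=> //.
    by exists [set v | p v != 0]%SET => // v /=; rewrite inE negbK => /eqP.
  move=> [p0 [p1 [a aX pa]]]; split=> // [v|]; first exact: p0.
  apply: Xdown aX _; apply/fintype.subsetP => v; rewrite inE.
  by apply: contraR => /pa ->.
have closed_coord v (D : set R) : closed D -> closed [set p : pts | D (p v)].
  by move: D; apply/continuous_closedP; apply: coord_continuous.
apply: closedI; last apply: closedI.
- by apply: closed_bigI => v _; apply: (closed_coord v [set r | 0 <= r]); apply: closed_ge.
- have /continuous_closedP sum_closed : continuous (fun p : pts => \sum_v p v).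
    by apply: continuous_sumr => v; apply: coord_continuous.
  exact: sum_closed (closed_eq (y := 1)).
- apply: closed_bigcup.
    exact: finite_finset.
  move=> a _; apply: closed_bigI => v _.
  by apply: (closed_coord v [set 0]); apply: closed_eq.
Qed.

Lemma carrier_compact (X : {set {set T}}) :
  simplicial_complex X -> compact (carrier (R := R) X).
Proof.
move=> Xcx; apply: (@subclosed_compact _ _ [set p : pts | forall v, `[0, 1]%classic (p v)]).
- exact: carrier_closed.
- by apply: (@tychonoff T (fun=> R) (fun=> `[0, 1]%classic)) => v; apply: segment_compact.
move=> p [p0 p1 _] v /=; rewrite in_itv /= p0 -p1 (bigD1 v) //=.
by rewrite lerDl sumr_ge0.
Qed.

Lemma carrier_second_countable (X : {set {set T}}) :
  simplicial_complex X -> second_countable (T := carrier (R := R) X).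
Proof.
move=> /carrier_compact cX.
exact: (@compact_subtype_second_countable R {ptws T -> R} (carrier X) cX).
Qed.
End Carrier.

(** * Charts on open stars *)

Section Chart.
Local Open Scope classical_set_scope.
Local Open Scope ring_scope.
Variables (R : realType) (T : finType) (X : {set {set T}}).
Variables (v : T) (s : seq T).
Hypothesis star : cyclic_star X v s.
Local Notation pts := {ptws T -> R}.

Let m := (size s).-2.
Let m_gt0 : (0 < m)%N. Proof. by rewrite /m; case: star => _ + _; lia. Qed.
Let sz : size s = m.+2. Proof. by rewrite /m; case: star => _ + _; lia. Qed.
Let vs : v \notin s. Proof. by case: star => /andP[]. Qed.
Let us : uniq s. Proof. by case: star => /andP[]. Qed.

Lemma next_nth_index k : (k < size s)%N ->
  next s (nth v s k) = nth v s (if k == m.+1 then 0%N else k.+1).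
Proof.
move=> ks; rewrite next_nth mem_nth // index_uniq //.
case: (s) sz us ks => // y p; rewrite /= => -[szp] _ ks.
case: eqP => [->|km]; first by rewrite nth_default ?szp.
by apply: set_nth_default; rewrite szp; lia.
Qed.

(** Cyclic succession in [s] is adjacency of rays in the fan. *)
Lemma star_fan_adj (a : {set T}) : v \in a ->
  (a \in X) <-> exists i j, fan_adj m i j /\ a \subset [set v; nth v s i; nth v s j]%SET.
Proof.
have [_ _ starE] := star => va; rewrite starE //; split.
  move=> [q qs asub]; have qm : (index q s <= m.+1)%N by rewrite -ltnS -sz index_mem.
  have qE : nth v s (index q s) = q by rewrite nth_index.
  have nE : next s q = nth v s (if index q s == m.+1 then 0%N else (index q s).+1).
    by rewrite -next_nth_index ?qE // index_mem.
  case: eqP nE => [iE|iE] nE.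
    exists 0%N, m.+1; split; first by rewrite /fan_adj !eqxx orbT.
    by rewrite -nE -iE qE setUAC.
  exists (index q s), (index q s).+1; split; last by rewrite -nE qE.
  by rewrite /fan_adj eqxx /=; apply/orP; left; lia.
move=> [i [j [/orP[/andP[/eqP -> im]|/andP[/eqP -> /eqP ->]] asub]]].
  exists (nth v s i); first by rewrite mem_nth // sz; lia.
  by rewrite next_nth_index ?sz ?ifN //; lia.
exists (nth v s m.+1); first by rewrite mem_nth // sz.
by rewrite next_nth_index ?sz // eqxx setUAC.
Qed.

Definition chart (p : pts) : R * R := fan_point m (fun k => p (nth v s k)).

(** The coordinate at [v] is what the fan coordinates leave of the total [1]. *)
Definition chart_inv (z : R * R) : pts := fun u =>
  if u == v then 1 - \sum_(k < m.+2) fan_hat m z k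
  else if u \in s then fan_hat m z (index u s) else 0.

Lemma sum_cyclic_star (p : pts) : (forall u, u \notin v :: s -> p u = 0) ->
  \sum_u p u = p v + \sum_(k < m.+2) p (nth v s k).
Proof.
move=> p0; rewrite (bigD1 v) //=; congr (_ + _).
rewrite (bigID (mem s)) /= addrC big1 ?add0r; last first.
  by move=> u /andP[uv us']; apply: p0; rewrite inE negb_or uv.
rewrite -sz -(big_mkord xpredT (fun k => p (nth v s k))) -(big_nth v xpredT p) big_uniq //=.
apply: eq_bigl => u; case us' : (u \in s); rewrite ?andbF // andbT.
by apply: contraNneq vs => <-.
Qed.

(** The support is a face through [v], so apart from [v] it has at most two
    consecutive vertices of the cycle. *)
Lemma carrier_off_star (p : pts) : carrier X p -> p v != 0 ->
  exists i j, [/\ fan_adj m i j, fan_supported m (fun k => p (nth v s k)) i j &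
    forall u, u \notin v :: s -> p u = 0].
Proof.
move=> [p0 p1 pX] pv; have /star_fan_adj : v \in [set u | p u != 0]%SET by rewrite inE.
case=> /(_ pX) [i [j [adj /fintype.subsetP sub]]] _.
have ijm : (i <= m.+1)%N /\ (j <= m.+1)%N by move: adj; rewrite /fan_adj; lia.
have p_out u : u != v -> u != nth v s i -> u != nth v s j -> p u = 0.
  move=> uv ui uj; apply: contraNeq uv => pu; have := sub u.
  by rewrite !inE (negPf ui) (negPf uj) !orbF; apply.
exists i, j; split=> //.
  split=> [k //|k km ki kj]; apply: p_out; rewrite ?nth_uniq ?sz //; try lia.
  by apply: contraNneq vs => <-; rewrite mem_nth // sz; lia.
move=> u; rewrite inE negb_or => /andP[uv us']; apply: p_out => //.
  by apply: contraNneq us' => ->; rewrite mem_nth // sz; lia.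
by apply: contraNneq us' => ->; rewrite mem_nth // sz; lia.
Qed.

Lemma fan_hat_chart (p : pts) : carrier X p -> p v != 0 ->
  forall k, (k <= m.+1)%N -> fan_hat m (chart p) k = p (nth v s k).
Proof.
move=> Xp pv k km; have [i [j [adj sp _]]] := carrier_off_star Xp pv.
by rewrite (fan_hatK m_gt0 adj sp).
Qed.

Lemma sum_hat_chart (p : pts) : carrier X p -> p v != 0 ->
  \sum_(k < m.+2) fan_hat m (chart p) k = 1 - p v.
Proof.
move=> Xp pv; have [i [j [_ _ p_out]]] := carrier_off_star Xp pv.
have [_ <- _] := Xp; rewrite (sum_cyclic_star p_out) addrAC subrr add0r.
by apply: eq_bigr => k _; rewrite fan_hat_chart // -ltnS.
Qed.

Lemma chartK (p : pts) : carrier X p -> p v != 0 -> chart_inv (chart p) = p.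
Proof.
move=> Xp pv; have [i [j [_ _ p_out]]] := carrier_off_star Xp pv.
apply/funext => u; rewrite /chart_inv; case: eqVneq => [->|uv].
  by rewrite sum_hat_chart // opprB addrC subrK.
case: ifPn => us'; last by rewrite p_out // inE negb_or uv.
by rewrite fan_hat_chart ?nth_index // -ltnS -sz index_mem.
Qed.

Lemma chart_inv_nth z k : (k < m.+2)%N -> chart_inv z (nth v s k) = fan_hat m z k.
Proof.
move=> km; rewrite /chart_inv mem_nth ?sz // ifN ?index_uniq ?sz //.
by apply: contraNneq vs => <-; rewrite mem_nth ?sz.
Qed.

Lemma chart_invK z : chart (chart_inv z) = z.
Proof.
rewrite -[RHS](fan_pointK m_gt0) /chart /fan_point chart_inv_nth //.
by congr ((_ - _), (_ - _)); apply: eq_bigr => k _; rewrite chart_inv_nth // ltnW // ltnS.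
Qed.

Lemma chart_inv_carrier z : \sum_(k < m.+2) fan_hat m z k < 1 ->
  carrier X (chart_inv z) /\ chart_inv z v != 0.
Proof.
move=> zV; have nz : chart_inv z v != 0.
  by rewrite /chart_inv eqxx gt_eqF // subr_gt0.
split=> //; split.
- move=> u; rewrite /chart_inv; case: ifP => _; first by rewrite subr_ge0 ltW.
  by case: ifPn => // us'; rewrite fan_hat_ge0 // -ltnS -sz index_mem.
- rewrite sum_cyclic_star; last first.
    by move=> u; rewrite inE negb_or /chart_inv => /andP[/negPf -> /negPf ->].
  rewrite {1}/chart_inv eqxx -[RHS](subrK (\sum_(k < m.+2) fan_hat m z k)).
  by congr (_ + _); apply: eq_bigr => k _; rewrite chart_inv_nth.
apply/star_fan_adj; first by rewrite inE.
have [i [j [adj hat0]]] := fan_hat_supp m_gt0 z.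
exists i, j; split=> //; apply/fintype.subsetP => u; rewrite !inE.
rewrite /chart_inv; case: (eqVneq u v) => //= uv.
case: ifPn => us'; last by rewrite eqxx.
have um : (index u s <= m.+1)%N by rewrite -ltnS -sz index_mem.
rewrite -[u in (u == _) || _](nth_index v us') -[u in _ || (u == _)](nth_index v us').
case: (eqVneq (index u s) i) => [->|ui]; first by rewrite eqxx.
case: (eqVneq (index u s) j) => [->|uj]; first by rewrite eqxx orbT.
by rewrite hat0 ?eqxx.
Qed.

Lemma chart_continuous : continuous chart.
Proof.
have cw k : continuous (fun p : pts => p (nth v s k)) by apply: coord_continuous.
have cfst : continuous (fun p : pts => (chart p).1).
  apply: continuous_subr; first exact: continuous_sumr.
  exact: continuous_scaler.
have csnd : continuous (fun p : pts => (chart p).2).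
  apply: continuous_subr; last exact: continuous_scaler.
  by apply: continuous_sumr => k; apply: continuous_scaler.
exact: continuous_pairr cfst csnd.
Qed.

Lemma sum_hat_continuous : continuous (fun z : R * R => \sum_(k < m.+2) fan_hat m z k).
Proof. by apply: continuous_sumr => k; apply: fan_hat_continuous. Qed.

Lemma chart_inv_continuous : continuous chart_inv.
Proof.
apply: coords_continuous => u; rewrite /chart_inv; case: (u == v).
  apply: continuous_subr; last exact: sum_hat_continuous.
  by move=> z; apply: cvg_cst.
by case: (u \in s); [apply: fan_hat_continuous|move=> z; apply: cvg_cst].
Qed.

Definition open_star : set (carrier (R := R) X) :=
  [set p | (set_val p : pts) v != 0].
(** The points whose preimage has a positive coordinate at [v]. *)
Definition star_image : set (R * R) :=
  [set z | \sum_(k < m.+2) fan_hat m z k < 1].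

Lemma open_star_open : open open_star.
Proof.
exists [set p : pts | p v != 0] => //.
move/continuousP: (@coord_continuous R T v) => /(_ [set r | r != 0]).
by apply; apply: open_neq.
Qed.

Lemma star_image_open : open star_image.
Proof.
move/continuousP: sum_hat_continuous => /(_ [set r | r < 1]).
by apply; apply: open_lt.
Qed.

Lemma open_starP (p : open_star) :
  carrier X (set_val (set_val p)) /\ (set_val (set_val p) : pts) v != 0.
Proof. by split; [apply: set_valP|apply: (set_valP p)]. Qed.

Lemma chart_image (p : open_star) : star_image (chart (set_val (set_val p))).
Proof.
have [Xp pv] := open_starP p; rewrite /star_image /= sum_hat_chart //.
rewrite ltrBlDr ltrDl lt_neqAle eq_sym pv.
by have [p0 _ _] := Xp; apply: p0.
Qed.

Definition star_to_plane (p : open_star) : star_image :=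
  SigSub (mem_set (chart_image p)).

Lemma chart_inv_star (z : star_image) :
  open_star (SigSub (mem_set (chart_inv_carrier (set_valP z)).1)).
Proof. exact: (chart_inv_carrier (set_valP z)).2. Qed.

Definition plane_to_star (z : star_image) : open_star :=
  SigSub (mem_set (chart_inv_star z)).

Lemma open_star_homeomorphic : homeomorphic open_star star_image.
Proof.
exists star_to_plane, plane_to_star; split.
- apply: continuous_to_subtype => p /=.
  apply: (@continuous_comp _ _ _ (fun p => set_val (set_val p)) chart);
    last exact: chart_continuous.
  apply: (@continuous_comp _ _ _ set_val set_val); exact: set_val_continuous.
- apply: continuous_to_subtype; apply: continuous_to_subtype => z /=.
  apply: (@continuous_comp _ _ _ set_val chart_inv); last exact: chart_inv_continuous.
  exact: set_val_continuous.
- move=> p; apply/val_inj/val_inj; rewrite /=.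
  by have [Xp pv] := open_starP p; apply: chartK.
- by move=> z; apply/val_inj; rewrite /= chart_invK.
Qed.
End Chart.

Section ManifoldFromStars.
Local Open Scope ring_scope.

(** Coordinates of a point sum to [1], so one of them is nonzero and the point lies
    in the open star of that vertex. *)
Lemma cyclic_stars_closed_2manifold (R : realType) (T : finType) (X : {set {set T}}) :
  simplicial_complex X ->
  (forall v, v \in vertices X -> exists s, cyclic_star X v s) ->
  closed_triangulated_2manifold R X.
Proof.
move=> Xcx stars; split=> //; split.
- exact: compact_subtype (carrier_compact Xcx).
- apply: hausdorff_subtype; apply: (@hausdorff_product T (fun=> R)) => v.
  exact: Rhausdorff.
- exact: carrier_second_countable.
move=> p; have [_ Xdown] := Xcx; have [p0 p1 pX] := set_valP p.
have [v pv] : exists v, (set_val p : {ptws T -> R}) v != 0.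
  apply/not_existsP => pz; have := p1; rewrite big1.
    by move/esym/eqP; rewrite oner_eq0.
  by move=> v _; apply/eqP/negPn/negP/pz.
have vX : v \in vertices X.
  by rewrite inE; apply: Xdown pX _; rewrite sub1set inE.
have [s star] := stars v vX.
exists (@open_star R T X v), (@star_image R T s); split=> //.
- exact: open_star_open.
- exact: star_image_open.
- exact: open_star_homeomorphic star.
Qed.
End ManifoldFromStars.

(** * The induced cycle and its cone *)

Section InducedCycle.
Variables (T : finType) (M : {set {set T}}) (x : T) (A : {set T}).
Hypotheses (Mcx : simplicial_complex M) (AL : A \subset vertices (link M x)).
Let C := induced_subcomplex (link M x) A.

Lemma induced_link_vertices : [/\ vertices C = A, x \notin A & A \subset vertices M].
Proof.
have AV v : v \in A -> [/\ [set v] \in M, x != v & [set v] \in link M x].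
  move=> /(subsetP AL); rewrite inE => vL; split=> //; move: vL; rewrite inE => /and3P[] //.
  by rewrite inE.
split.
- apply/setP => v; rewrite !(inE, sub1set); apply/andP/idP => [[]//|vA]; split=> //.
  by have [_ _] := AV v vA; rewrite !inE.
- by apply/negP => /AV[_ + _]; rewrite eqxx.
- by apply/subsetP => v /AV[vM _ _]; rewrite inE.
Qed.

Lemma vertices_cone : is_cycle C -> vertices (cone x C) = x |: A.
Proof.
move=> [[C0 _] _ _ _ _]; have [<- _ _] := induced_link_vertices.
apply/setP => v; rewrite !inE; apply/idP/idP.
  move=> /orP[->|/imsetP[a _ /setP/(_ x)]]; first by rewrite orbT.
  by rewrite !inE eqxx eq_sym => ->.
move=> /orP[/eqP ->|->//]; apply/orP; right; apply/imsetP.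
by exists set0; rewrite ?setU0.
Qed.

Lemma induced_link_face (a : {set T}) : x \in a -> a \in M -> a \subset x |: A -> a :\ x \in C.
Proof.
move=> xa aM aA; have [_ Mdown] := Mcx.
rewrite !inE setD1K // aM eqxx (Mdown a) ?subsetDl //=.
by rewrite subDset.
Qed.

Lemma induced_link_edge q r :
  (q != r) && ([set q; r] \in C) = link_adj_in M A x q r.
Proof.
have [_ Mdown] := Mcx; rewrite /link_adj_in /link_adj !inE subUset !sub1set negb_or setUA.
case: (boolP ([set x; q; r] \in M)) => [xqrM|]; rewrite ?andbF //.
have -> : [set q; r] \in M by apply: Mdown xqrM _; rewrite -setUA subsetUr.
by case: (q \in A); case: (r \in A); case: (x != q); case: (x != r); rewrite ?andbF ?andbT.
Qed.

Lemma induced_cycle_face_card (a : {set T}) : is_cycle C ->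
  x \in a -> a \in M -> a \subset x |: A -> (#|a| <= 3)%N.
Proof.
move=> [_ _ _ dim _] xa aM aA; rewrite (cardsD1 x a) xa add1n ltnS -dim.
exact: (@leq_bigmax_cond _ (mem C) (fun b => #|b|) _ (induced_link_face xa aM aA)).
Qed.
End InducedCycle.

Theorem theorem3p5 (R : realType) (T : finType) (M : {set {set T}})
    (x : T) (C : {set {set T}}) :
  simplicial_complex M ->
  (exists F : fieldType, tight_complex F M) ->
  x \in vertices M ->
  induced_cycle (link M x) C ->
  closed_triangulated_2manifold R (induced_subcomplex M (vertices (cone x C))).
Proof.
move=> Mcx [F Mtight] xM [Ccyc [A AL CE]]; rewrite CE in Ccyc *.
have [CA xA AM] := induced_link_vertices AL; rewrite (vertices_cone AL Ccyc).
have [c [[uc sc cE] cA]] := cycle_cyclic_order Ccyc.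
have cO : cyclic_order (link_adj_in M A x) c.
  by split=> // q r; rewrite -(@induced_link_edge T M x A Mcx) cE.
have {}cA : c =i A by move=> v; rewrite cA CA.
have dim_x a := @induced_cycle_face_card T M x A Mcx a Ccyc.
apply: cyclic_stars_closed_2manifold.
  exact: induced_subcomplex_complex.
move=> v; rewrite !inE sub1set !inE => /andP[_ /orP[/eqP ->|vA]].
  by exists c; exact: (apex_star Mcx xA dim_x cO cA).
exact: (base_star Mcx Mtight xM AM xA dim_x cO cA vA).
Qed.
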